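(* Let $(M^n,g)$, $n\ge3$, be a homogeneous, proper, noncompact, nondegenerate, gradient Einstein-type manifold with both $\mu$ and $\alpha$ nonzero; that is, $(M^n,g)$ is a noncompact homogeneous Riemannian manifold and there are smooth functions $f,\lambda:M^n\to\mathbb{R}$ with $\lambda$ nonconstant and constants $\alpha,\beta,\mu,\rho\in\mathbb{R}$ with $\alpha,\beta,\mu\ne0$ and $\beta^2\neq(n-2)\alpha\mu$ such that $$\alpha\, Ric+\beta\,\nabla^2 f+\mu\, df\otimes df=(\rho S+\lambda)g .$$ If $\beta^2\neq-\mu\alpha$, then $(M^n,g)$ is an Einstein manifold.
   Context: All manifolds $(M^n,g)$ are connected smooth Riemannian manifolds of dimension $n\ge3$; $Ric$ and $S$ denote the Ricci tensor and the scalar curvature, and $\nabla^2 f$ the Hessian of $f$. $(M^n,g)$ is a gradient Einstein-type manifold with potential function $f$ if there are smooth functions $f,\lambda$ on $M$ and real constants $\alpha,\beta,\mu,\rho$ with $(\alpha,\beta,\mu)\ne(0,0,0)$ such that $\alpha Ric+\beta\nabla^2 f+\mu\,df\otimes df=(\rho S+\lambda)g$. It is nondegenerate if $\beta^2\ne(n-2)\alpha\mu$ and $\beta\neq0$, and proper if $\lambda$ is nonconstant on $M^n$. A manifold is Einstein if $Ric=\frac{S}{n}g$ (with $S$ then constant, as $n\ge3$). Homogeneous means that the isometry group acts transitively. *)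

(* Defs.v *)
(* Smooth manifolds and Riemannian metrics are presented by an atlas, and
   tensor fields by their component matrices in each chart. *)
From mathcomp Require Import all_boot all_order all_algebra.
From mathcomp Require Import all_classical all_reals all_analysis.
Import Order.TTheory GRing.Theory Num.Theory.
Import numFieldNormedType.Exports.

Set Implicit Arguments.
Unset Strict Implicit.
Unset Printing Implicit Defensive.

Local Open Scope classical_set_scope.
Local Open Scope ring_scope.

Section EuclideanCalculus.
Context {R : realType} {n : nat}.

Definition basis_vec (i : 'I_n) : 'rV[R]_n := delta_mx 0 i.

Definition partial (i : 'I_n) (h : 'rV[R]_n -> R) : 'rV[R]_n -> R :=
  fun x => 'D_(basis_vec i) h x.

Fixpoint Ck_on (k : nat) (U : set 'rV[R]_n) (h : 'rV[R]_n -> R) : Prop :=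
  {within U, continuous h} /\
  if k is k'.+1 then
    forall i : 'I_n,
      (forall x, U x -> derivable h x (basis_vec i)) /\
      Ck_on k' U (partial i h)
  else True.

(* Only used with U open. *)
Definition smooth_on (U : set 'rV[R]_n) (h : 'rV[R]_n -> R) : Prop :=
  forall k, Ck_on k U h.

End EuclideanCalculus.

(* The values of cmap outside dom and of cinv outside cmap @` dom are
   irrelevant. *)
Record chart (R : realType) (n : nat) (M : topologicalType) := Chart {
  dom : set M;
  cmap : M -> 'rV[R]_n;
  cinv : 'rV[R]_n -> M;
  dom_open : open dom;
  img_open : open (cmap @` dom);
  cmapK : forall p, dom p -> cinv (cmap p) = p;
  cmap_continuous : {within dom, continuous cmap};
  cinv_continuous : {within cmap @` dom, continuous cinv} }.

Definition img (R : realType) (n : nat) (M : topologicalType)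
  (c : chart R n M) : set 'rV[R]_n := cmap c @` dom c.

Section MapsInCharts.
Context {R : realType} {n : nat} {M : topologicalType}.
Implicit Types (phi : M -> M) (c d : chart R n M).

Definition local_map phi c d : 'rV[R]_n -> 'rV[R]_n :=
  fun x => cmap d (phi (cinv c x)).

Definition local_dom phi c d : set 'rV[R]_n :=
  [set x | img c x /\ dom d (phi (cinv c x))].

Definition smooth_in_charts phi c d : Prop :=
  forall i : 'I_n,
    smooth_on (local_dom phi c d) (fun x => local_map phi c d x 0 i).

(* Row-vector convention: 'J F x sends v to v *m 'J F x, so this is the
   matrix of (v, w) |-> B (dF v) (dF w). *)
Definition pullback_mx (F : 'rV[R]_n -> 'rV[R]_n) (B : 'M[R]_n)
  (x : 'rV[R]_n) : 'M[R]_n :=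
  'J F x *m B *m ('J F x)^T.

End MapsInCharts.

(* The atlas need not be maximal; only the components of the metric in charts
   of the atlas matter. *)
Record riemannianManifold (R : realType) (n : nat) := RiemannianManifold {
  carrier :> topologicalType;
  atlas : set (chart R n carrier);
  metric : chart R n carrier -> 'rV[R]_n -> 'M[R]_n;
  carrier_hausdorff : hausdorff_space carrier;
  carrier_second_countable : @second_countable carrier;
  carrier_connected : connected [set: carrier];
  atlas_cover : forall p : carrier, exists2 c, atlas c & dom c p;
  atlas_compatible : forall c d, atlas c -> atlas d -> smooth_in_charts id c d;
  metric_smooth : forall c, atlas c ->
    forall i j, smooth_on (img c) (fun x => metric c x i j);
  metric_sym : forall c, atlas c ->
    forall x, img c x -> (metric c x)^T = metric c x;
  metric_posdef : forall c, atlas c -> forall x, img c x ->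
    forall v : 'rV[R]_n, v != 0 -> 0 < (v *m metric c x *m v^T) 0 0;
  metric_compatible : forall c d, atlas c -> atlas d ->
    forall x, local_dom id c d x ->
    metric c x =
      pullback_mx (local_map id c d) (metric d (local_map id c d x)) x }.

Section Geometry.
Context {R : realType} {n : nat} (M : riemannianManifold R n).
Implicit Types (c d : chart R n M) (x : 'rV[R]_n) (i j k l : 'I_n).

Definition smooth_fun (f : M -> R) : Prop :=
  forall c, atlas c -> smooth_on (img c) (fun x => f (cinv c x)).

Definition smooth_map (phi : M -> M) : Prop :=
  continuous phi /\
  forall c d, atlas c -> atlas d -> smooth_in_charts phi c d.

Definition isometry (phi : M -> M) : Prop :=
  [/\ smooth_map phi,
      exists psi : M -> M, [/\ cancel phi psi, cancel psi phi & smooth_map psi]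
    & forall c d, atlas c -> atlas d -> forall x, local_dom phi c d x ->
        metric c x =
          pullback_mx (local_map phi c d) (metric d (local_map phi c d x)) x].

Definition homogeneous : Prop :=
  forall p q : M, exists2 phi : M -> M, isometry phi & phi p = q.

Definition metric_inv c x : 'M[R]_n := invmx (metric c x).

(* Gamma^k_ij of the Levi-Civita connection *)
Definition christoffel c k i j x : R :=
  2^-1 * \sum_l metric_inv c x k l *
    (partial i (fun y => metric c y j l) x +
     partial j (fun y => metric c y i l) x -
     partial l (fun y => metric c y i j) x).

(* The l-th component of R(d_i, d_j) d_k, where
   R(X, Y) = [nabla_X, nabla_Y] - nabla_[X, Y]. *)
Definition curvature c l k i j x : R :=
  partial i (christoffel c l j k) x - partial j (christoffel c l i k) x +
  \sum_m (christoffel c l i m x * christoffel c m j k x -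
          christoffel c l j m x * christoffel c m i k x).

(* Ric(Y, Z) is the trace of X |-> R(X, Y) Z. *)
Definition ricci c x : 'M[R]_n :=
  \matrix_(j, k) \sum_i curvature c i k i j x.

Definition scalar_curvature c x : R :=
  \sum_i \sum_j metric_inv c x i j * ricci c x i j.

Definition differential_mx (f : M -> R) c x : 'rV[R]_n :=
  \row_i partial i (fun y => f (cinv c y)) x.

Definition hessian (f : M -> R) c x : 'M[R]_n :=
  \matrix_(i, j)
    (partial i (partial j (fun y => f (cinv c y))) x -
     \sum_k christoffel c k i j x * differential_mx f c x 0 k).

Definition tensor_square (f : M -> R) c x : 'M[R]_n :=
  (differential_mx f c x)^T *m differential_mx f c x.

Definition gradient_einstein_type (f lambda : M -> R)
    (alpha beta mu rho : R) : Prop :=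
  [/\ smooth_fun f, smooth_fun lambda, (alpha, beta, mu) <> (0, 0, 0)
    & forall c, atlas c -> forall x, img c x ->
        alpha *: ricci c x + beta *: hessian f c x + mu *: tensor_square f c x
        = (rho * scalar_curvature c x + lambda (cinv c x)) *: metric c x].

Definition nondegenerate_constants (alpha beta mu : R) : Prop :=
  beta ^+ 2 <> (n%:R - 2) * alpha * mu /\ beta <> 0.

Definition proper_function (lambda : M -> R) : Prop :=
  exists p q : M, lambda p <> lambda q.

Definition noncompact : Prop := ~ compact [set: M].

Definition einstein : Prop :=
  forall c, atlas c -> forall x, img c x ->
    ricci c x = (scalar_curvature c x / n%:R) *: metric c x.

End Geometry.

Arguments nondegenerate_constants {R} n alpha beta mu.

(* Main.v *)
(* Put u = exp (mu / beta * f) and q = mu * alpha / beta ^ 2, let S be the scalar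
   curvature, constant by homogeneity, and A = Ric - (S / n) g.  The equation becomes
   Hess u = phi g - q u A, and lambda is an affine function of phi / u.
   Commuting covariant derivatives and using the contracted Bianchi identity
   (div A = 0) gives (1 - n) dphi = (1 + q) A(grad u) + (S / n) du.  As 1 + q <> 0, the
   symmetry of Hess phi forces the Codazzi defect of A to vanish on grad u; then
   pairing the Ricci identity with grad u gives (1 - (n - 2) q) A(grad u) /\ du = 0.
   So A(grad u) = sigma grad u where du <> 0; by homogeneity the characteristic
   polynomial of the Ricci endomorphism is constant, hence sigma is locally constant,
   and the divergence of A(grad u) = sigma grad u reads - q u |A|^2 = n sigma phi.
   If the constant |A|^2 is nonzero then lambda takes finitely many values on the set
   du <> 0; this set is dense (du = 0 on an open set gives Hess u = 0, hence A = 0), so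
   lambda is constant by connectedness.  Otherwise A = 0. *)
Require Import Defs.
From HB Require Import structures.
From mathcomp Require Import all_boot all_order all_algebra.
From mathcomp Require Import ring lra.
From mathcomp Require Import all_classical all_reals all_analysis.
Import Order.TTheory GRing.Theory Num.Theory.
Import numFieldNormedType.Exports.
Set Implicit Arguments.
Unset Strict Implicit.
Unset Printing Implicit Defensive.
Local Open Scope ring_scope.

(** * Connections over a ring with commuting derivations *)

(** The tensor calculus takes place over an abstract commutative ring with commuting derivations,
    where each identity is purely algebraic; the ring is later taken to be the smooth functions on a
    nonempty open subset of a chart image. That ring has zero divisors, so 2, 1 + q and 1 - (n - 2)
    q are required to be cancellable rather than nonzero. The last two are nonzero constants because
    beta^2 differs from - mu alpha and from (n - 2) alpha mu. The eigenvalue sigma is the point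
    where the ring no longer suffices: it is a quotient, defined only where some component of du is
    nonzero, while the divergence computation wants it constant. Continuity together with finitely
    many possible values makes it constant on a smaller open set, and the algebra is applied again
    over the ring of that set. Homogeneity is used through one fact: an isometry transforms the
    metric and Ricci by the same Jacobian, so the matrices g^-1 Ric at any two points are conjugate.
    Their trace, characteristic polynomial and |A|^2 are then constant. *)

Section MatrixZmodule.
Context {V : zmodType} {m n : nat}.
Implicit Types A B : 'M[V]_(m, n).

Lemma trmxD A B : (A + B)^T = A^T + B^T.
Proof. by apply/matrixP=> i j; rewrite !mxE. Qed.
Lemma trmxB A B : (A - B)^T = A^T - B^T.
Proof. by apply/matrixP=> i j; rewrite !mxE. Qed.
Lemma colB j A B : col j (A - B) = col j A - col j B.
Proof. by apply/matrixP=> i k; rewrite !mxE. Qed.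
End MatrixZmodule.

Lemma mxtraceB (K : pzRingType) n (A B : 'M[K]_n) : \tr (A - B) = \tr A - \tr B.
Proof. exact: raddfB. Qed.

Lemma mxtraceN (K : pzRingType) n (A : 'M[K]_n) : \tr (- A) = - \tr A.
Proof. exact: raddfN. Qed.

(** Abstract model of the coordinate derivatives. Commutation says that coordinate fields have zero
    brackets, so [curv] has no bracket term. *)
Definition derivations (K : comNzRingType) (n : nat) (D : 'I_n -> K -> K) : Prop :=
  [/\ forall i a b, D i (a + b) = D i a + D i b,
      forall i a b, D i (a * b) = D i a * b + a * D i b
    & forall i j a, D i (D j a) = D j (D i a)].

(* [G i] is the matrix whose entry [(j, k)] is the Christoffel symbol Gamma^k_ij. *)
Definition levi_civita (K : comNzRingType) (n : nat) (D : 'I_n -> K -> K)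
    (g : 'M[K]_n) (G : 'I_n -> 'M[K]_n) : Prop :=
  (forall i, map_mx (D i) g = G i *m g + (G i *m g)^T) /\
  (forall i j k, G i j k = G j i k).

(* Entry [(k, l)] of [curv D G i j] is the l-th component of R(d_i, d_j) d_k; as row
   vectors are used, it is the transpose of the usual endomorphism. *)
Definition curv (K : comNzRingType) (n : nat) (D : 'I_n -> K -> K)
    (G : 'I_n -> 'M[K]_n) (i j : 'I_n) : 'M[K]_n :=
  map_mx (D i) (G j) - map_mx (D j) (G i) - (G i *m G j - G j *m G i).

Definition ric (K : comNzRingType) (n : nat) (D : 'I_n -> K -> K)
    (G : 'I_n -> 'M[K]_n) : 'M[K]_n :=
  \matrix_(j, k) \sum_i curv D G i j k i.

(** Links the matrix form of Ricci to the classical coordinate formula once [F] evaluates at a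
    point. The derivatives of the Christoffel symbols are supplied separately as [dC], since such an
    evaluation does not commute with [D]. *)
Lemma rmorph_ric (K : comNzRingType) (L : comNzRingType) (F : {rmorphism K -> L}) (n : nat)
    (D : 'I_n -> K -> K) (G : 'I_n -> 'M[K]_n)
    (dC : 'I_n -> 'I_n -> 'I_n -> 'I_n -> L) (C : 'I_n -> 'I_n -> 'I_n -> L) j k :
  (forall i j k l, F (D i (G j k l)) = dC i j k l) ->
  (forall i j k, F (G i j k) = C k i j) ->
  F (ric D G j k) = \sum_i (dC i j k i - dC j i k i +
    \sum_m (C i i m * C m j k - C i j m * C m i k)).
Proof.
move=> dCE CE; rewrite !mxE raddf_sum; apply: eq_bigr => i _.
rewrite /curv !mxE !raddfB /= !dCE; congr (_ + _).
rewrite opprK addrC (raddf_sum F) (raddf_sum F) sumrB.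
by congr (_ - _); apply: eq_bigr => m _; rewrite /= rmorphM /= !CE mulrC.
Qed.

Section CovariantDerivative.
Context {K : comNzRingType} {n : nat} (D : 'I_n -> K -> K).
Context (G : 'I_n -> 'M[K]_n).

(** The covariant derivative along the i-th coordinate field of the covariant 2-tensor with
    component matrix [B]. *)
Definition cov i (B : 'M[K]_n) := map_mx (D i) B - G i *m B - B *m (G i)^T.

(* The curvature is differentiated as an endomorphism-valued 2-form. *)
Definition curv_cov m i j :=
  map_mx (D m) (curv D G i j) - G m *m curv D G i j + curv D G i j *m G m
  - \sum_p G m i p *: curv D G p j - \sum_p G m j p *: curv D G i p.

Definition divergence (h B : 'M[K]_n) j := \sum_m \sum_k h m k * cov m B j k.

End CovariantDerivative.

Section Derivations.
Context {K : comNzRingType} {n : nat} {D : 'I_n -> K -> K}.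
Hypothesis HD : derivations D.

Lemma derivD i a b : D i (a + b) = D i a + D i b. Proof. by case: HD. Qed.
Lemma derivM i a b : D i (a * b) = D i a * b + a * D i b. Proof. by case: HD. Qed.
Lemma derivC i j a : D i (D j a) = D j (D i a). Proof. by case: HD. Qed.
Lemma deriv0 i : D i 0 = 0.
Proof. by apply: (@addrI _ (D i 0)); rewrite -derivD !addr0. Qed.
Lemma derivN i a : D i (- a) = - D i a.
Proof. by apply: (@addrI _ (D i a)); rewrite -derivD !subrr deriv0. Qed.
Lemma derivB i a b : D i (a - b) = D i a - D i b.
Proof. by rewrite derivD derivN. Qed.
Lemma deriv1 i : D i 1 = 0.
Proof.
by apply: (@addrI _ (D i 1)); rewrite addr0 -{3}[1]mulr1 derivM mulr1 mul1r.
Qed.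
Lemma deriv_nat i m : D i m%:R = 0.
Proof. by elim: m => [|m IH]; rewrite ?deriv0 // -natr1 derivD IH deriv1 addr0. Qed.
Lemma deriv_sum i (I : Type) (r : seq I) (P : pred I) (F : I -> K) :
  D i (\sum_(k <- r | P k) F k) = \sum_(k <- r | P k) D i (F k).
Proof. exact: (big_morph (D i) (derivD i) (deriv0 i)). Qed.

Section Matrix.
Context {m p : nat}.
Implicit Types A B : 'M[K]_(m, p).

Lemma derivmxD i A B : map_mx (D i) (A + B) = map_mx (D i) A + map_mx (D i) B.
Proof. by apply/matrixP=> j k; rewrite !mxE derivD. Qed.
Lemma derivmxN i A : map_mx (D i) (- A) = - map_mx (D i) A.
Proof. by apply/matrixP=> j k; rewrite !mxE derivN. Qed.
Lemma derivmxB i A B : map_mx (D i) (A - B) = map_mx (D i) A - map_mx (D i) B.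
Proof. by rewrite derivmxD derivmxN. Qed.
Lemma derivmxC i j A : map_mx (D i) (map_mx (D j) A) = map_mx (D j) (map_mx (D i) A).
Proof. by apply/matrixP=> k l; rewrite !mxE derivC. Qed.
Lemma derivmxZ i a A : map_mx (D i) (a *: A) = D i a *: A + a *: map_mx (D i) A.
Proof. by apply/matrixP=> j k; rewrite !mxE derivM. Qed.
Lemma derivmx_sum i (I : Type) (r : seq I) (P : pred I) (F : I -> 'M[K]_(m, p)) :
  map_mx (D i) (\sum_(k <- r | P k) F k) = \sum_(k <- r | P k) map_mx (D i) (F k).
Proof.
apply: (big_morph (map_mx (D i)) (derivmxD i)).
by apply/matrixP=> j k; rewrite !mxE deriv0.
Qed.
End Matrix.

Lemma derivmxM i (m p r : nat) (A : 'M[K]_(m, p)) (B : 'M[K]_(p, r)) :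
  map_mx (D i) (A *m B) = map_mx (D i) A *m B + A *m map_mx (D i) B.
Proof.
apply/matrixP=> j k; rewrite !mxE deriv_sum -big_split; apply: eq_bigr => l _.
by rewrite derivM !mxE.
Qed.
Lemma derivmx1 i (m : nat) : map_mx (D i) (1%:M : 'M[K]_m) = 0.
Proof. by apply/matrixP=> j k; rewrite !mxE; case: eqP; rewrite ?deriv1 ?deriv0. Qed.
Lemma deriv_trace i (m : nat) (A : 'M[K]_m) : D i (\tr A) = \tr (map_mx (D i) A).
Proof. by rewrite /mxtrace deriv_sum; apply: eq_bigr => j _; rewrite mxE. Qed.

End Derivations.

(** * Symmetries of the curvature and the contracted Bianchi identity *)

Section Connection.
Context {K : comNzRingType} {n : nat} {D : 'I_n -> K -> K}.
Hypothesis HD : derivations D.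
Context {g h : 'M[K]_n} {G : 'I_n -> 'M[K]_n}.
Hypothesis g_sym : g^T = g.
Hypothesis gh : g *m h = 1%:M.
Hypothesis HG : levi_civita D g G.

Local Notation cov := (cov D G).
Local Notation curv_cov := (curv_cov D G).
Local Notation divergence := (divergence D G h).

Let hg : h *m g = 1%:M. Proof. exact: mulmx1C. Qed.

Lemma inverse_sym : h^T = h.
Proof.
have := congr1 trmx gh; rewrite trmx_mul g_sym trmx1 => e.
by rewrite -[h^T]mulmx1 -gh mulmxA e mul1mx.
Qed.

Lemma torsion_free i j k : G i j k = G j i k. Proof. by case: HG. Qed.

Lemma deriv_metric i : map_mx (D i) g = G i *m g + g *m (G i)^T.
Proof. by case: HG => -> _; rewrite trmx_mul g_sym. Qed.

Lemma deriv_metric_inv i : map_mx (D i) h = - ((G i)^T *m h + h *m G i).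
Proof.
have e : map_mx (D i) h = - (h *m map_mx (D i) g *m h).
  apply/eqP; rewrite -subr_eq0 opprK -[X in X + _]mul1mx -hg -!mulmxA -mulmxDr.
  by rewrite addrC -(derivmxM HD) gh (derivmx1 HD) mulmx0.
rewrite e deriv_metric mulmxDr mulmxDl !mulmxA hg mul1mx -!mulmxA gh mulmx1.
by rewrite addrC.
Qed.

Lemma curvC i j : curv D G i j = - curv D G j i.
Proof. by apply/matrixP=> a b; rewrite /curv !mxE; ring. Qed.

Let lcurv i j := curv D G i j *m g.

(** Second derivatives of [g] commute. When both orders are expanded by metric compatibility, all
    terms cancel except the lowered curvature and its transpose. *)
Lemma lcurv_anti i j : (curv D G i j *m g)^T = - (curv D G i j *m g).
Proof.
apply/eqP; rewrite -addr_eq0 trmx_mul g_sym.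
have := derivmxC HD i j g; rewrite !deriv_metric !(derivmxD HD) !(derivmxM HD) !deriv_metric.
rewrite -!map_trmx => /eqP; rewrite -subr_eq0 => /eqP e.
apply/eqP; rewrite -[RHS]e /curv !(trmxB, trmxD) !trmx_mul.
rewrite !(mulmxDl, mulmxDr, mulmxBl, mulmxBr, mulNmx, mulmxN, mulmxA).
apply/matrixP=> a b; rewrite !(mxE, opprD) .
ring.
Qed.

Lemma cov_metric i : cov i g = 0.
Proof. by rewrite /cov deriv_metric addrAC addrK subrr. Qed.

Lemma covD i A B : cov i (A + B) = cov i A + cov i B.
Proof.
rewrite /cov (derivmxD HD) mulmxDr mulmxDl.
by apply/matrixP=> a b; rewrite !(mxE, opprD); ring.
Qed.

Lemma covZ i a A : D i a = 0 -> cov i (a *: A) = a *: cov i A.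
Proof.
move=> a0; rewrite /cov (derivmxZ HD) a0 scale0r add0r -scalemxAr -scalemxAl.
by rewrite !scalerBr.
Qed.

Lemma cov_sym i A : A^T = A -> (cov i A)^T = cov i A.
Proof.
move=> sA; rewrite /cov !trmxB !trmx_mul sA trmxK map_trmx sA.
by rewrite addrAC.
Qed.

(** The inverse metric is parallel ([deriv_metric_inv]), so contraction with [h] commutes with
    covariant differentiation. *)
Lemma trace_cov j B : \tr (h *m cov j B) = D j (\tr (h *m B)).
Proof.
rewrite (deriv_trace HD) (derivmxM HD) deriv_metric_inv /cov !mulmxBr mulNmx mulmxDl.
rewrite !(mxtraceB, mxtraceD, mxtraceN) !mulmxA [\tr (_ *m _ *m (G j)^T)]mxtrace_mulC !mulmxA.
ring.
Qed.

(** In the cyclic sum the Christoffel terms acting on the two form indices cancel in pairs, by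
    torsion-freeness and [curvC]. What remains is the Jacobi identity for the operators [D i] minus
    [G i]. *)
Lemma second_bianchi m i j : curv_cov m i j + curv_cov i j m + curv_cov j m i = 0.
Proof.
have -> : curv_cov m i j + curv_cov i j m + curv_cov j m i =
  (map_mx (D m) (curv D G i j) - G m *m curv D G i j + curv D G i j *m G m) +
  (map_mx (D i) (curv D G j m) - G i *m curv D G j m + curv D G j m *m G i) +
  (map_mx (D j) (curv D G m i) - G j *m curv D G m i + curv D G m i *m G j).
  have := curvC; rewrite /curv_cov; move: (curv D G) => C CC.
  have e a b c : \sum_p G a b p *: C p c = - \sum_p G b a p *: C c p.
    by rewrite -sumrN; apply: eq_bigr => p _; rewrite CC scalerN torsion_free.
  rewrite (e m i j) (e i j m) (e j m i) !opprK.
  move: (\sum_p _) (\sum_p _) (\sum_p _) => x1 x2 x3.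
  move: (_ + C i j *m G m) (_ + C j m *m G i) (_ + C m i *m G j) => y1 y2 y3.
  by apply/matrixP=> a b; rewrite !mxE; ring.
rewrite /curv !(derivmxB HD) !(derivmxM HD).
rewrite (derivmxC HD m i) (derivmxC HD m j) (derivmxC HD i j).
rewrite !(mulmxDl, mulmxDr, mulmxBl, mulmxBr, mulNmx, mulmxN, mulmxA).
apply/matrixP=> a b; rewrite !(mxE, opprD).
ring.
Qed.

(** Contracting an upper with a lower index commutes with covariant differentiation: the connection
    terms on the output index and on the form index i cancel each other. *)
Lemma trace_curv_cov m j k : \sum_i curv_cov m i j k i = cov m (ric D G) j k.
Proof.
have ricE a b : ric D G a b = \sum_i curv D G i a b i by rewrite mxE.
rewrite /curv_cov /cov; move: (ric D G) (curv D G) ricE => Rc C ricE.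
under eq_bigr => i _ do rewrite !mxE !summxE.
rewrite !big_split /= !sumrN !mxE.
have -> : \sum_i D m (C i j k i) = D m (Rc j k) by rewrite ricE (deriv_sum HD).
have -> : \sum_i \sum_t C i j k t * G m t i = \sum_i \sum_t (G m i t *: C t j) k i.
  by rewrite exchange_big; do 2!(apply: eq_bigr => ? _); rewrite !mxE mulrC.
have -> : \sum_i \sum_t G m k t * C i j t i = \sum_t Rc j t * (G m)^T t k.
  rewrite exchange_big; apply: eq_bigr => t _.
  by rewrite mxE -big_distrr /= mulrC -ricE.
have -> : \sum_i \sum_t (G m j t *: C i t) k i = \sum_t G m j t * Rc t k.
  rewrite exchange_big; apply: eq_bigr => t _; rewrite ricE big_distrr /=.
  by apply: eq_bigr => i _; rewrite !mxE.
ring.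
Qed.

Lemma curv_covC m i j : curv_cov m i j = - curv_cov m j i.
Proof.
have := curvC; rewrite /curv_cov; move: (curv D G) => C CC.
rewrite (CC i j) (derivmxN HD) mulmxN mulNmx.
have e a b : \sum_p G m b p *: C a p = - \sum_p G m b p *: C p a.
  by rewrite -sumrN; apply: eq_bigr => p _; rewrite CC scalerN.
have -> : \sum_p G m i p *: C p j = - \sum_p G m i p *: C j p by rewrite e opprK.
rewrite (e i j); move: (\sum_p _) (\sum_p _) (_ *m G m) (G m *m _) (map_mx _ _) => x1 x2 y1 y2 y3.
by apply/matrixP=> a b; rewrite !mxE; ring.
Qed.

(** Since [g] is parallel, lowering the index commutes with covariant differentiation, so the
    antisymmetry of [lcurv] is inherited by its derivative. *)
Lemma lcurv_cov_anti m i j :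
  (curv_cov m i j *m g)^T = - (curv_cov m i j *m g).
Proof.
have e : curv_cov m i j *m g =
  map_mx (D m) (lcurv i j) - G m *m lcurv i j - lcurv i j *m (G m)^T
  - \sum_p G m i p *: lcurv p j - \sum_p G m j p *: lcurv i p.
  rewrite /curv_cov /lcurv; move: (curv D G) => C; rewrite !mulmxBl mulmxDl mulmxBl.
  congr (_ - _ - _); last 2 first.
  - by rewrite mulmx_suml; apply: eq_bigr => p _; rewrite scalemxAl.
  - by rewrite mulmx_suml; apply: eq_bigr => p _; rewrite scalemxAl.
  rewrite (derivmxM HD) deriv_metric mulmxDr !mulmxA.
  move: (map_mx _ _ *m g) (G m *m _ *m g) (C i j *m G m *m g).
  move: (_ *m (G m)^T) => W X Y Z.
  by apply/matrixP=> a b; rewrite !mxE; ring.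
rewrite e; have : forall a b, (lcurv a b)^T = - lcurv a b := lcurv_anti.
move: lcurv => L {e} La.
rewrite !trmxB !trmx_mul trmxK map_trmx La (derivmxN HD) !mulNmx !mulmxN.
have ts (c : 'I_n -> K) (F : 'I_n -> 'M[K]_n) :
    (forall p, (F p)^T = - F p) -> (\sum_p c p *: F p)^T = - \sum_p c p *: F p.
  move=> Fa; rewrite linear_sum -sumrN; apply: eq_bigr => p _.
  by rewrite linearZ /= Fa scalerN.
rewrite !ts //; try by move=> p; apply: La.
set x1 := \sum_p _; set x2 := \sum_p _.
by apply/matrixP=> a b; rewrite !mxE; ring.
Qed.

(** Contract the second Bianchi identity with [h] over m, k and the output index with i. Two of the
    cyclic terms each give the divergence of Ricci, the third gives minus the derivative of its
    trace. The sum of two equal terms avoids dividing by 2 in the ring. *)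
Lemma contracted_bianchi j :
  divergence (ric D G) j + divergence (ric D G) j = D j (\tr (h *m ric D G)).
Proof.
have hs a b : h a b = h b a by rewrite -{1}inverse_sym mxE.
have e1 : \sum_m \sum_k \sum_i h m k * curv_cov m i j k i = divergence (ric D G) j.
  by do 2!(apply: eq_bigr => ? _); rewrite -big_distrr /= trace_curv_cov.
have e3 : \sum_m \sum_k \sum_i h m k * curv_cov j m i k i = - D j (\tr (h *m ric D G)).
  rewrite -trace_cov /mxtrace -sumrN; under [RHS]eq_bigr do rewrite mxE -sumrN.
  rewrite exchange_big; apply: eq_bigr => k _; apply: eq_bigr => m _.
  rewrite -big_distrr /= -mulrN -trace_curv_cov hs -sumrN; congr (_ * _).
  by apply: eq_bigr => i _; rewrite curv_covC mxE.
(* Here the output index is traced with the direction of differentiation. Antisymmetry of the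
   lowered tensor exchanges it with the slot paired through [h], which gives the shape required by
   [trace_curv_cov]. *)
have e2 : \sum_m \sum_k \sum_i h m k * curv_cov i j m k i = divergence (ric D G) j.
  have N i m k l : curv_cov i j m k l = \sum_p (curv_cov i j m *m g) k p * h p l.
    by rewrite -[curv_cov i j m in LHS]mulmx1 -gh mulmxA mxE.
  have Na i m k p : (curv_cov i j m *m g) k p = - (curv_cov i j m *m g) p k.
    by have := congr1 (fun X : 'M[K]_n => X p k) (lcurv_cov_anti i j m); rewrite /= mxE [RHS]mxE.
  transitivity (- \sum_i \sum_p \sum_m h i p * curv_cov i j m p m); last first.
    rewrite -sumrN; apply: eq_bigr => i _; rewrite -sumrN; apply: eq_bigr => p _.
    rewrite -big_distrr /= -mulrN -trace_curv_cov -sumrN; congr (_ * _).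
    by apply: eq_bigr => m _; rewrite curv_covC mxE opprK.
  under eq_bigr do under eq_bigr do under eq_bigr do rewrite N big_distrr /=.
  under [X in - X]eq_bigr do under eq_bigr do under eq_bigr do rewrite N big_distrr /=.
  rewrite -sumrN; under [LHS]eq_bigr do rewrite exchange_big /=.
  rewrite [LHS]exchange_big /=; apply: eq_bigr => i _.
  rewrite -sumrN; under [LHS]eq_bigr do rewrite exchange_big /=.
  rewrite [LHS]exchange_big /=; apply: eq_bigr => p _.
  rewrite -sumrN; apply: eq_bigr => m _; rewrite -sumrN; apply: eq_bigr => k _.
  by rewrite [in RHS]Na (hs p i) (hs k m); ring.
have splitE (a1 a2 a3 : 'I_n -> 'I_n -> 'I_n -> K) :
    \sum_m \sum_k \sum_i h m k * (a1 m k i + a2 m k i + a3 m k i) =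
    \sum_m \sum_k \sum_i h m k * a1 m k i + \sum_m \sum_k \sum_i h m k * a2 m k i
    + \sum_m \sum_k \sum_i h m k * a3 m k i.
  rewrite -!big_split; apply: eq_bigr => m _; rewrite -!big_split; apply: eq_bigr => k _.
  by rewrite -!big_split; apply: eq_bigr => i _; rewrite /= !mulrDr.
have Z : \sum_m \sum_k \sum_i
    h m k * (curv_cov m i j k i + curv_cov i j m k i + curv_cov j m i k i) = 0.
  rewrite big1 // => m _; rewrite big1 // => k _; rewrite big1 // => i _.
  have := congr1 (fun X : 'M[K]_n => X k i) (second_bianchi m i j).
  by rewrite [LHS]mxE [X in X + _]mxE [RHS]mxE => ->; rewrite mulr0.
apply/eqP; rewrite -subr_eq0; apply/eqP; refine (etrans _ (etrans (esym (splitE _ _ _)) Z)).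
exact: esym (congr2 _ (congr2 _ e1 e2) e3).
Qed.

End Connection.

(** * Consequences of the Hessian equation over an abstract ring *)

Section EinsteinType.
Context {K : comNzRingType} {n : nat} {D : 'I_n -> K -> K}.
Hypothesis HD : derivations D.
Hypothesis two_regular : forall a : K, a + a = 0 -> a = 0.
Context {g h : 'M[K]_n} {G : 'I_n -> 'M[K]_n}.
Hypothesis g_sym : g^T = g.
Hypothesis gh : g *m h = 1%:M.
Hypothesis HG : levi_civita D g G.
Context {A : 'M[K]_n} {s : K}.
Hypothesis ricE : ric D G = A + s *: g.
Hypothesis A_sym : A^T = A.
Hypothesis s_cst : forall i, D i s = 0.
Hypothesis trA : \tr (h *m A) = 0.

Local Notation cov := (cov D G).
Local Notation divergence := (divergence D G h).

Let hg : h *m g = 1%:M. Proof. exact: mulmx1C. Qed.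
Let hC a b : h a b = h b a. Proof. by rewrite -{1}(inverse_sym g_sym gh) mxE. Qed.
Let AC a b : A a b = A b a. Proof. by rewrite -{1}A_sym mxE. Qed.
Let gC a b : g a b = g b a. Proof. by rewrite -{1}g_sym mxE. Qed.
Let covAC i a b : cov i A a b = cov i A b a.
Proof. by rewrite -{1}(cov_sym i A_sym) mxE. Qed.

Lemma tracefree_divergence_free j : divergence A j = 0.
Proof.
apply: two_regular.
have -> : divergence A j = divergence (ric D G) j.
  apply: eq_bigr => m _; apply: eq_bigr => k _; rewrite ricE (covD HD) (covZ HD) //.
  by rewrite (cov_metric g_sym HG) scaler0 addr0.
rewrite (contracted_bianchi HD g_sym gh HG) ricE mulmxDr mxtraceD trA add0r.
rewrite -scalemxAr hg mxtraceZ (derivM HD) s_cst mul0r add0r mxtrace1.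
by rewrite (deriv_nat HD) mulr0.
Qed.

(** [N k] is the covariant derivative of the covector [w]. The Christoffel terms on the direction
    index are left out: for a torsion-free connection they are symmetric in i, j and would disappear
    from the difference. *)
Lemma ricci_identity i j (w : 'cV[K]_n) :
  let N k := map_mx (D k) w - G k *m w in
  map_mx (D i) (N j) - G i *m N j - (map_mx (D j) (N i) - G j *m N i)
  = - (curv D G i j *m w).
Proof.
move=> N; rewrite /N /curv !(derivmxB HD) !(derivmxM HD) (derivmxC HD j i).
rewrite !(mulmxDl, mulmxDr, mulmxBl, mulmxBr, mulNmx, mulmxN, mulmxA).
apply/matrixP=> a b; rewrite !(mxE, opprD).
ring.
Qed.

(** On the left, column j is a covector with j a mere label. The term by which [cov] differs, column
    j of [B *m (G i)^T], is symmetric in i and j because the torsion vanishes. *)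
Lemma codazzi_defect i j (B : 'M[K]_n) :
  map_mx (D i) (col j B) - G i *m col j B - (map_mx (D j) (col i B) - G j *m col i B)
  = col j (cov i B) - col i (cov j B).
Proof.
have e : col j (B *m (G i)^T) = col i (B *m (G j)^T).
  apply/matrixP=> a b; rewrite !mxE; apply: eq_bigr => l _.
  by rewrite !mxE (torsion_free HG).
rewrite /cov !colB e; have cM b (X : 'M[K]_n) : col b (X *m B) = X *m col b B by rewrite !colE mulmxA.
rewrite !cM -!map_col.
move: (map_mx (D i) _) (map_mx (D j) _) (G i *m _) (G j *m _) (col i (_ *m _))  => X Y Z V W.
by apply/matrixP=> a b; rewrite !mxE; ring.
Qed.

Context {u phi q : K}.
Hypothesis q_cst : forall i, D i q = 0.
Let du : 'cV[K]_n := \col_i D i u.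
Hypothesis hess : forall i,
  map_mx (D i) du - G i *m du = phi *: col i g - (q * u) *: col i A.
Hypothesis q1_regular : forall a : K, (1 + q) * a = 0 -> a = 0.
Hypothesis q2_regular : forall a : K, (1 - (n%:R - 2) * q) * a = 0 -> a = 0.

(** The Ricci identity for du with its Hessian replaced through [hess]. The metric has no Codazzi
    defect, being parallel; that of [A] appears with weight [q * u]. *)
Lemma curv_gradient i j k :
  D i phi * g k j - D j phi * g k i - q * (D i u * A k j - D j u * A k i)
  - q * u * (cov i A k j - cov j A k i)
  = - (curv D G i j *m du) k 0.
Proof.
pose T t (w : 'cV[K]_n) := map_mx (D t) w - G t *m w.
have TZ t a w : T t (a *: w) = D t a *: w + a *: T t w.
  by rewrite /T (derivmxZ HD) scalerBr -scalemxAr addrA.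
have TB t w w' : T t (w - w') = T t w - T t w'.
  rewrite /T (derivmxB HD) mulmxBr; move: (map_mx _ _) (map_mx _ _) (_ *m _) (_ *m _).
  by move=> a b c d; apply/matrixP=> x y; rewrite !mxE; ring.
have := ricci_identity i j du; rewrite /= !hess -!/(T _ _) !TB !TZ.
have := codazzi_defect i j g; have := codazzi_defect i j A.
rewrite -!/(T _ _) !(cov_metric g_sym HG).
move: (T _ _) (T _ _) (T _ _) (T _ _) => a b c d.
move=> /(congr1 (fun X : 'cV[K]_n => X k 0)) + /(congr1 (fun X : 'cV[K]_n => X k 0)).
rewrite !mxE subrr => eA /eqP; rewrite subr_eq0 => /eqP eg.
move=> /(congr1 (fun X : 'cV[K]_n => X k 0)); rewrite !mxE => <-.
rewrite !(derivM HD) !q_cst -eA eg; ring.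
Qed.


(** Antisymmetry of the lowered curvature moves the contraction onto the pair of indices that
    defines [ric]; the price is the sign. *)
Lemma contracted_curv j (w : 'cV[K]_n) :
  \sum_i \sum_k h i k * (curv D G i j *m w) k 0 = - (ric D G *m h *m w) j 0.
Proof.
have La i p k : (curv D G i j *m g) k p = - (curv D G i j *m g) p k.
  have := congr1 (fun X : 'M[K]_n => X p k) (lcurv_anti HD g_sym HG i j).
  by rewrite mxE [RHS]mxE.
have e i k : (curv D G i j *m w) k 0 = - \sum_p (curv D G i j *m g) p k * (h *m w) p 0.
  rewrite -[curv D G i j in LHS]mulmx1 -gh !mulmxA -[LHS]/((_ *m _) _ _) -mulmxA mxE -sumrN.
  by apply: eq_bigr => p _; rewrite La mulNr.
under eq_bigr do under eq_bigr do rewrite e mulrN big_distrr /=.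
under eq_bigr do rewrite sumrN exchange_big /=.
rewrite sumrN exchange_big /= -mulmxA mxE; congr (- _); apply: eq_bigr => p _.
rewrite [ric _ _ _ _]mxE big_distrl; apply: eq_bigr => i _ /=.
rewrite -[curv D G i j in RHS]mulmx1 -gh mulmxA [in RHS]mxE big_distrl.
by apply: eq_bigr => k _; rewrite hC mulrCA mulrA.
Qed.

(** The covector A(grad u). *)
Let X := A *m h *m du.

(** Trace of [curv_gradient] over i and k. The two halves of the defect become the divergence of [A]
    and the derivative of its trace, both zero; the two metric terms give 1 and n = tr (h g). *)
Lemma deriv_phi j : (1 - n%:R) * D j phi = (1 + q) * X j 0 + s * D j u.
Proof.
have gj a : \sum_i \sum_k h i k * (a i * g k j) = a j.
  rewrite (bigD1 j) //= [X in _ + X]big1 ?addr0 => [|i ij].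
    under eq_bigr do rewrite mulrCA; rewrite -big_distrr /=.
    have := congr1 (fun X : 'M[K]_n => X j j) hg; rewrite !mxE eqxx => ->.
    by rewrite mulr1.
  under eq_bigr do rewrite mulrCA; rewrite -big_distrr /=.
  have := congr1 (fun X : 'M[K]_n => X i j) hg; rewrite !mxE (negbTE ij) => ->.
  by rewrite mulr0.
have tr c (B : 'M[K]_n) : \sum_i \sum_k h i k * (c * B k i) = c * \tr (h *m B).
  rewrite /mxtrace big_distrr; apply: eq_bigr => i _ /=; rewrite mxE big_distrr.
  by apply: eq_bigr => k _; rewrite mulrCA.
have trg : \tr (h *m g) = n%:R by rewrite hg mxtrace1.
have Xj : \sum_i \sum_k h i k * (D i u * A k j) = X j 0.
  rewrite exchange_big /X -mulmxA mxE; apply: eq_bigr => k _.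
  rewrite mxE big_distrr; apply: eq_bigr => i _ /=.
  by rewrite !mxE (AC k j) (hC i k); ring.
have dv : \sum_i \sum_k h i k * cov i A k j = 0.
  rewrite -[RHS](tracefree_divergence_free j) /divergence; apply: eq_bigr => i _.
  by apply: eq_bigr => k _; rewrite covAC.
have trc : \sum_i \sum_k h i k * cov j A k i = 0.
  transitivity (\tr (h *m cov j A)); last by rewrite (trace_cov HD g_sym gh HG) trA (deriv0 HD).
  by apply: eq_bigr => i _; rewrite mxE.
have : \sum_i \sum_k h i k * - (curv D G i j *m du) k 0 = (ric D G *m h *m du) j 0.
  apply: oppr_inj; rewrite -contracted_curv -sumrN; apply: eq_bigr => i _.
  by rewrite -sumrN; apply: eq_bigr => k _; rewrite mulrN opprK.
under eq_bigr => i _ do under eq_bigr => k _ do rewrite -curv_gradient.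
have -> : \sum_i \sum_k h i k *
   (D i phi * g k j - D j phi * g k i - q * (D i u * A k j - D j u * A k i) -
    q * u * (cov i A k j - cov j A k i)) =
  \sum_i \sum_k h i k * (D i phi * g k j) - \sum_i \sum_k h i k * (D j phi * g k i)
  - q * (\sum_i \sum_k h i k * (D i u * A k j) - \sum_i \sum_k h i k * (D j u * A k i))
  - q * u * (\sum_i \sum_k h i k * cov i A k j - \sum_i \sum_k h i k * cov j A k i).
  rewrite -!sumrB !big_distrr -!sumrB /=; apply: eq_bigr => i _.
  rewrite -!sumrB !big_distrr -!sumrB /=; apply: eq_bigr => k _.
  ring.
have -> : (ric D G *m h *m du) j 0 = X j 0 + s * D j u.
  rewrite ricE !mulmxDl -!scalemxAl gh mul1mx.
  by rewrite [LHS]mxE -/X [X in _ + X]mxE [du _ _]mxE.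
rewrite gj !tr trg trA Xj dv trc => e.
rewrite mulrBl mul1r [n%:R * _]mulrC.
transitivity (q * X j 0 + (X j 0 + s * D j u)); last by ring.
by rewrite -e; ring.
Qed.

Let v := h *m du.

Let cov_X i : map_mx (D i) X - G i *m X =
  cov i A *m v + A *m h *m (map_mx (D i) du - G i *m du).
Proof.
rewrite /X /v !(derivmxM HD) (deriv_metric_inv HD g_sym gh HG) /cov.
rewrite !(mulmxDl, mulmxDr, mulmxBl, mulmxBr, mulNmx, mulmxN, mulmxA, opprD).
apply/matrixP=> a b; rewrite !(mxE, opprD).
ring.
Qed.

Let hess_entry i j : D i (D j u) - (G i *m du) j 0 = phi * g j i - q * u * A j i.
Proof. by have := congr1 (fun X : 'cV[K]_n => X j 0) (hess i); rewrite !mxE. Qed.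

Let Ah_hess i j :
  (A *m h *m (map_mx (D i) du - G i *m du)) j 0
  = phi * A j i - q * u * (A *m h *m A) j i.
Proof.
by rewrite hess mulmxBr -!scalemxAr !colE !mulmxA -!colE -(mulmxA A h g) hg mulmx1 !mxE.
Qed.

(** Differentiating [deriv_phi] and antisymmetrizing leaves (1 + q) times the exterior derivative of
    [X]. By the product rule this equals the defect paired with [v] plus a term A h Hess u, and the
    latter is phi A - q u A h A, which is symmetric. *)
Lemma codazzi_gradient i j : (cov i A *m v) j 0 = (cov j A *m v) i 0.
Proof.
apply/eqP; rewrite -subr_eq0; apply/eqP; apply: q1_regular.
have AhA a b : (A *m h *m A) a b = (A *m h *m A) b a.
  have e : (A *m h *m A)^T = A *m h *m A by rewrite !trmx_mul A_sym (inverse_sym g_sym gh) mulmxA.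
  by rewrite -{1}e mxE.
have e a b : (cov a A *m v) b 0 =
    D a (X b 0) - (G a *m X) b 0 - phi * A b a + q * u * (A *m h *m A) b a.
  have := congr1 (fun X : 'cV[K]_n => X b 0) (cov_X a).
  by rewrite [RHS]mxE Ah_hess !mxE => ->; ring.
have GX : (G i *m X) j 0 = (G j *m X) i 0.
  by rewrite !mxE; apply: eq_bigr => k _; rewrite (torsion_free HG).
rewrite !e GX (AhA i j) (AC i j).
have := congr1 (D j) (deriv_phi i); have := congr1 (D i) (deriv_phi j).
have cn k : D k (1 - n%:R) = 0 by rewrite (derivB HD) (deriv1 HD) (deriv_nat HD) subr0.
have cq k : D k (1 + q) = 0 by rewrite (derivD HD) (deriv1 HD) q_cst addr0.
rewrite !(derivD HD) !(derivM HD) !cn !cq !s_cst !(mul0r, add0r).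
rewrite (derivC HD j i phi) (derivC HD j i u) => -> e'.
have {}e' : (1 + q) * (D i (X j 0) - D j (X i 0)) = 0.
  by rewrite mulrBr; apply/eqP; rewrite subr_eq0; apply/eqP; apply: addIr e'.
by rewrite -[RHS]e'; ring.
Qed.

Lemma gradient_parallel i j : X i 0 * D j u = X j 0 * D i u.
Proof.
apply/eqP; rewrite -subr_eq0; apply/eqP; apply: q2_regular.
have gv k : \sum_l v l 0 * g l k = D k u.
  have := congr1 (fun X : 'cV[K]_n => X k 0) (mulmxA g h du).
  rewrite gh mul1mx [RHS]mxE => <-; rewrite -/v mxE; apply: eq_bigr => l _.
  by rewrite mulrC gC.
have Av k : \sum_l v l 0 * A l k = X k 0.
  by rewrite /X -mulmxA -/v mxE; apply: eq_bigr => l _; rewrite mulrC AC.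
have cv a b : \sum_l v l 0 * cov a A l b = (cov a A *m v) b 0.
  by rewrite mxE; apply: eq_bigr => l _; rewrite mulrC covAC.
have Kv : \sum_l v l 0 * (curv D G i j *m du) l 0 = 0.
  have duE : du = g *m v by rewrite /v mulmxA gh mul1mx.
  have -> : \sum_l v l 0 * (curv D G i j *m du) l 0 = (v^T *m (curv D G i j *m g) *m v) 0 0.
    by rewrite -mulmxA -mulmxA -duE mxE; apply: eq_bigr => l _; rewrite [v^T _ _]mxE.
  have := lcurv_anti HD g_sym HG i j; move: (curv D G i j *m g) => L La.
  have := congr1 (fun Y : 'M[K]_1 => Y 0 0) (trmx_mul (v^T *m L) v).
  rewrite [(v^T *m L)^T]trmx_mul La trmxK mulNmx mulmxN mulmxA mxE [RHS]mxE => e.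
  by apply: two_regular; rewrite {1}e addNr.
have : \sum_l v l 0 * - (curv D G i j *m du) l 0 = 0.
  by under eq_bigr do rewrite mulrN; rewrite sumrN Kv oppr0.
under eq_bigr => k _ do rewrite -curv_gradient.
have -> : \sum_k v k 0 *
   (D i phi * g k j - D j phi * g k i - q * (D i u * A k j - D j u * A k i) -
    q * u * (cov i A k j - cov j A k i)) =
   D i phi * (\sum_k v k 0 * g k j) - D j phi * (\sum_k v k 0 * g k i)
   - q * (D i u * (\sum_k v k 0 * A k j) - D j u * (\sum_k v k 0 * A k i))
   - q * u * (\sum_k v k 0 * cov i A k j - \sum_k v k 0 * cov j A k i).
  rewrite !big_distrr -!sumrB !big_distrr -!sumrB /=; apply: eq_bigr => k _; ring.
(* The factor 1 - n lets [deriv_phi] eliminate the derivatives of [phi]. The resulting coefficient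
   is (1 + q) + (1 - n) q = 1 - (n - 2) q. *)
rewrite !gv !Av !cv codazzi_gradient => /(congr1 (fun x => (1 - n%:R) * x)).
rewrite mulr0 => e.
have {e} : (1 - n%:R) * D i phi * D j u - (1 - n%:R) * D j phi * D i u
   - (1 - n%:R) * q * (D i u * X j 0 - D j u * X i 0) = 0 by rewrite -[RHS]e; ring.
by rewrite !deriv_phi => e; rewrite -[RHS]e; ring.
Qed.

(** The divergence of [X] in two ways: as sigma times the trace of the Hessian of u, that is n sigma
    phi, and by the product rule as div A (grad u) = 0 plus the pairing of [A] with the Hessian, in
    which only - q u |A|^2 survives since [A] is tracefree. *)
Lemma eigen_divergence sigma : (forall i, D i sigma = 0) -> X = sigma *: du ->
  - (q * u * \tr (h *m A *m h *m A)) = n%:R * sigma * phi.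
Proof.
move=> sc XE.
have trh (B : 'M[K]_n) : \sum_i \sum_j h i j * B j i = \tr (h *m B).
  by rewrite /mxtrace; apply: eq_bigr => i _; rewrite mxE.
have e1 : \sum_i \sum_j h i j * (map_mx (D i) X - G i *m X) j 0 = n%:R * sigma * phi.
  have e i j : (map_mx (D i) X - G i *m X) j 0 = sigma * phi * g j i - sigma * q * u * A j i.
    rewrite XE (derivmxZ HD) sc scale0r add0r -scalemxAr -scalerBr mxE.
    by rewrite -mulrA -!mulrA -mulrBr mulrA -hess_entry !mxE.
  under eq_bigr do under eq_bigr do rewrite e mulrBr !(mulrCA (h _ _)).
  under eq_bigr do rewrite sumrB -!big_distrr /=.
  rewrite sumrB -!big_distrr /= !trh trA hg mxtrace1; ring.
rewrite -{}e1; under [RHS]eq_bigr do under eq_bigr do rewrite cov_X mxE Ah_hess mulrDr.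
under [RHS]eq_bigr do rewrite big_split /=.
rewrite big_split /= [X in X + _](_ : _ = 0) ?add0r.
  under [RHS]eq_bigr do under eq_bigr do rewrite mulrBr !(mulrCA (h _ _)).
  under [RHS]eq_bigr do rewrite sumrB -!big_distrr /=.
  by rewrite sumrB -!big_distrr /= !trh trA mulr0 sub0r !mulmxA.
under eq_bigr do under eq_bigr do rewrite mxE big_distrr /=.
under eq_bigr do rewrite exchange_big /=.
rewrite exchange_big big1 // => k _.
transitivity (v k 0 * divergence A k); last by rewrite tracefree_divergence_free mulr0.
rewrite /divergence big_distrr; apply: eq_bigr => i _; rewrite big_distrr; apply: eq_bigr => j _ /=.
by rewrite mulrA mulrC covAC.
Qed.

End EinsteinType.

(** * Uniqueness and existence of the Levi-Civita connection *)

Lemma levi_civita_unique (K : comNzRingType) (n : nat) (D : 'I_n -> K -> K)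
    (g h : 'M[K]_n) (G G' : 'I_n -> 'M[K]_n) :
  (forall a : K, a + a = 0 -> a = 0) -> g *m h = 1%:M ->
  levi_civita D g G -> levi_civita D g G' -> G =1 G'.
Proof.
move=> two_regular gh [mG tG] [mG' tG'].
(* The lowered difference of the connections is symmetric in its first two indices and antisymmetric
   in its last two. Alternating these two symmetries returns to the same entry with the opposite
   sign. *)
pose e i := (G i - G' i) *m g.
have e_anti i j k : e i j k = - e i k j.
  have : e i + (e i)^T = 0.
    rewrite /e mulmxBl trmxB addrACA -opprD -mG mG' subrr //.
  by move=> /(congr1 (fun X : 'M[K]_n => X j k)); rewrite !mxE => /eqP; rewrite addr_eq0 => /eqP.
have e_sym i j k : e i j k = e j i k.
  by rewrite !mxE; apply: eq_bigr => l _; rewrite !mxE tG tG'.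
move=> i; apply/eqP; rewrite -subr_eq0 -[G i - _]mulmx1 -gh mulmxA -/(e i).
suff -> : e i = 0 by rewrite mul0mx.
apply/matrixP=> j k; rewrite [RHS]mxE; apply: two_regular.
by rewrite {1}e_anti e_sym e_anti opprK e_sym [X in X + _]e_anti e_sym addNr.
Qed.

(** The usual Christoffel symbols; [half] is a parameter because the ring provides no division. *)
Definition koszul (K : comNzRingType) (n : nat) (D : 'I_n -> K -> K) (half : K)
    (g h : 'M[K]_n) (i : 'I_n) : 'M[K]_n :=
  \matrix_(j, k) (half * \sum_l h k l * (D i (g j l) + D j (g i l) - D l (g i j))).

Lemma koszul_levi_civita (K : comNzRingType) (n : nat) (D : 'I_n -> K -> K)
    (half : K) (g h : 'M[K]_n) :
  half + half = 1 -> g^T = g -> g *m h = 1%:M -> levi_civita D g (koszul D half g h).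
Proof.
move=> halfE g_sym gh.
have gC i j : g i j = g j i by rewrite -{1}g_sym mxE.
have hgE l m : \sum_k h k l * g k m = (l == m)%:R.
  have := congr1 (fun X : 'M[K]_n => X m l) gh; rewrite mxE [RHS]mxE eq_sym => <-.
  by apply: eq_bigr => k _; rewrite mulrC gC.
split=> [i|i j k]; last first.
  rewrite mxE [RHS]mxE; congr (_ * _); apply: eq_bigr => l _.
  by rewrite (gC j i) [D i _ + _]addrC.
have E j m : (koszul D half g h i *m g) j m =
    half * (D i (g j m) + D j (g i m) - D m (g i j)).
  rewrite mxE.
  transitivity (\sum_l half * (D i (g j l) + D j (g i l) - D l (g i j))
     * \sum_k h k l * g k m).
    under [RHS]eq_bigr do rewrite big_distrr /=.
    rewrite exchange_big /=; apply: eq_bigr => k _; rewrite mxE.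
    rewrite big_distrr big_distrl; apply: eq_bigr => l _ /=; ring.
  under eq_bigr do rewrite hgE.
  rewrite (bigD1 m) //= eqxx mulr1 big1 ?addr0 // => l /negbTE lm.
  by rewrite lm mulr0.
apply/matrixP=> j k; rewrite mxE [RHS]mxE [X in _ + X]mxE !E (gC k j).
rewrite -[LHS]mul1r -halfE; ring.
Qed.

(** * Connection, curvature and Ricci tensor under pullback *)

Section Naturality.
Context {K K' : comNzRingType} {n : nat}.
Context {D : 'I_n -> K -> K} {D' : 'I_n -> K' -> K'}.
Hypothesis HD : derivations D.
Hypothesis two_regular : forall a : K, a + a = 0 -> a = 0.
Context {F : {rmorphism K' -> K}} {J : 'M[K]_n}.
Hypothesis chain : forall i b, D i (F b) = \sum_a J i a * F (D' a b).
Hypothesis J_closed : forall i j a, D i (J j a) = D j (J i a).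
Context {g h : 'M[K]_n} {g' : 'M[K']_n} {G : 'I_n -> 'M[K]_n} {G' : 'I_n -> 'M[K']_n}.
Hypothesis gh : g *m h = 1%:M.
Hypothesis g'_sym : g'^T = g'.
Hypothesis g_pullback : g = J *m map_mx F g' *m J^T.
Hypothesis HG : levi_civita D g G.
Hypothesis HG' : levi_civita D' g' G'.

(** The inverse Jacobian, read off from [g_pullback] and the invertibility of [g]. *)
Let I : 'M[K]_n := map_mx F g' *m J^T *m h.
Let JI : J *m I = 1%:M.
Proof. by rewrite /I !mulmxA -g_pullback. Qed.
Let IJ : I *m J = 1%:M. Proof. exact: mulmx1C. Qed.

Let chain_mx i (B : 'M[K']_n) :
  map_mx (D i) (map_mx F B) = \sum_a J i a *: map_mx F (map_mx (D' a) B).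
Proof.
apply/matrixP=> k l; rewrite !mxE chain summxE; apply: eq_bigr => a _.
by rewrite !mxE.
Qed.

Let pG i := \sum_a J i a *: map_mx F (G' a).

(** The transformation law of Christoffel symbols. The connection [G2] defined by this law is metric
    and torsion-free for [g], the latter by [J_closed], hence equals [G] by uniqueness. *)
Let connection_pullback i : G i *m J = map_mx (D i) J + J *m pG i.
Proof.
pose G2 i := (map_mx (D i) J + J *m pG i) *m I.
suff /(levi_civita_unique two_regular gh HG) -> : levi_civita D g G2.
  by rewrite /G2 -mulmxA IJ mulmx1.
have G2J j : G2 j *m J = map_mx (D j) J + J *m pG j by rewrite /G2 -mulmxA IJ mulmx1.
split=> [j|j k l].
  have e : \sum_a J j a *: map_mx F (map_mx (D' a) g') =
      pG j *m map_mx F g' + (pG j *m map_mx F g')^T.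
    rewrite /pG mulmx_suml linear_sum -big_split; apply: eq_bigr => a _ /=.
    rewrite -!scalemxAl linearZ /= -scalerDr -map_mxM map_trmx -raddfD /=.
    by rewrite HG'.1.
  have P_sym : (map_mx F g')^T = map_mx F g' by rewrite map_trmx g'_sym.
  have gE : G2 j *m g = (map_mx (D j) J + J *m pG j) *m map_mx F g' *m J^T.
    by rewrite [g in LHS]g_pullback !mulmxA G2J.
  have gET : (G2 j *m g)^T = J *m map_mx F g' *m ((map_mx (D j) J)^T + (pG j)^T *m J^T).
    rewrite gE trmx_mul trmxK -[RHS]mulmxA; congr (_ *m _).
    by rewrite trmx_mul P_sym trmxD trmx_mul.
  rewrite trmx_mul P_sym -chain_mx in e.
  rewrite gET gE [in LHS]g_pullback !(derivmxM HD) e map_trmx.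
  rewrite !(mulmxDl, mulmxDr, mulmxA) -!addrA; congr (_ + (_ + _)).
  by rewrite addrC.
have e a b c : (G2 a *m J) b c = (G2 b *m J) a c.
  rewrite !G2J /pG !mulmx_sumr.
  rewrite !mxE !summxE J_closed; congr (_ + _).
  have E x y : \sum_i (J *m (J x i *: map_mx F (G' i))) y c =
     \sum_i \sum_t J x i * J y t * F (G' i t c).
    by apply: eq_bigr => i' _; rewrite mxE; apply: eq_bigr => t _; rewrite !mxE; ring.
  rewrite !E exchange_big; apply: eq_bigr => x _; apply: eq_bigr => y _ /=.
  by rewrite HG'.2 [J _ _ * _]mulrC.
have G2E a : G2 a = G2 a *m J *m I by rewrite -mulmxA JI mulmx1.
by rewrite (G2E j) (G2E k) !mxE; apply: eq_bigr => t _; rewrite e.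
Qed.

(** [J] acts as a gauge transformation from [pG] to [G], under which curvature is conjugated. The
    curvature of [pG] is the pulled back 2-form, as the derivatives of [J] cancel by [J_closed]. *)
Let curv_pullback i j :
  curv D G i j *m J = J *m \sum_a \sum_b (J i a * J j b) *: map_mx F (curv D' G' a b).
Proof.
have e : curv D G i j *m J = J *m (curv D pG i j).
  have dG a b : map_mx (D a) (G b) *m J = map_mx (D a) (map_mx (D b) J) + map_mx (D a) J *m pG b
      + J *m map_mx (D a) (pG b) - G b *m map_mx (D a) J.
    apply/eqP; rewrite -subr_eq opprK -(derivmxM HD) connection_pullback.
    by rewrite (derivmxD HD) (derivmxM HD) addrA.
  have GG a b : G a *m G b *m J = G a *m map_mx (D b) J + map_mx (D a) J *m pG b + J *m pG a *m pG b.
    by rewrite -mulmxA connection_pullback mulmxDr mulmxA connection_pullback mulmxDl addrA.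
  rewrite /curv !mulmxBl !dG !GG !mulmxBr (derivmxC HD j i) !mulmxA.
  apply/matrixP=> x y; rewrite !(mxE, opprD).
  ring.
rewrite e; congr (_ *m _).
have dpG a b : map_mx (D a) (pG b) = \sum_t D a (J b t) *: map_mx F (G' t) +
    \sum_x \sum_y (J a x * J b y) *: map_mx F (map_mx (D' x) (G' y)).
  rewrite /pG (derivmx_sum HD) exchange_big -big_split; apply: eq_bigr => y _ /=.
  rewrite (derivmxZ HD) chain_mx scaler_sumr; congr (_ + _); apply: eq_bigr => x _.
  by rewrite scalerA mulrC.
have GG a b : pG a *m pG b = \sum_x \sum_y (J a x * J b y) *: map_mx F (G' x *m G' y).
  rewrite /pG mulmx_suml; apply: eq_bigr => x _; rewrite mulmx_sumr; apply: eq_bigr => y _.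
  by rewrite -scalemxAl -scalemxAr scalerA map_mxM.
have swap (H : 'I_n -> 'I_n -> 'M[K]_n) :
    \sum_x \sum_y (J j x * J i y) *: H x y = \sum_x \sum_y (J i x * J j y) *: H y x.
  by rewrite exchange_big; do 2!(apply: eq_bigr => ? _); rewrite mulrC.
rewrite {1}/curv !dpG !GG !swap.
have -> : \sum_t D i (J j t) *: map_mx F (G' t) = \sum_t D j (J i t) *: map_mx F (G' t).
  by apply: eq_bigr => t _; rewrite J_closed.
rewrite opprD addrACA subrr add0r -!sumrB; apply: eq_bigr => x _.
rewrite -!sumrB; apply: eq_bigr => y _; rewrite -!scalerBr; congr (_ *: _).
by rewrite -!map_mxB.
Qed.

(** In the contraction the Jacobian on the form index i meets the inverse Jacobian on the output
    index, and [I *m J] is the identity. *)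
Lemma ricci_pullback : ric D G = J *m map_mx F (ric D' G') *m J^T.
Proof.
apply/matrixP=> j k.
transitivity (\sum_i \sum_a \sum_b J i a * J j b * (J *m map_mx F (curv D' G' a b) *m I) k i).
  rewrite mxE; apply: eq_bigr => i _.
  rewrite -[curv D G i j]mulmx1 -JI mulmxA curv_pullback mulmx_sumr mulmx_suml summxE.
  apply: eq_bigr => a _; rewrite mulmx_sumr mulmx_suml summxE.
  by apply: eq_bigr => b _; rewrite -scalemxAr -scalemxAl mxE.
have ricE a b : map_mx F (ric D' G') b a = \sum_t map_mx F (curv D' G' t b) a t.
  by rewrite mxE [ric _ _ _ _]mxE raddf_sum; apply: eq_bigr => t _; rewrite [RHS]mxE.
transitivity (\sum_a \sum_b J j b * (J *m map_mx F (curv D' G' a b) *m (I *m J)) k a).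
  rewrite exchange_big; apply: eq_bigr => a _.
  rewrite exchange_big; apply: eq_bigr => b _ /=; rewrite mulmxA [in RHS]mxE big_distrr.
  by apply: eq_bigr => t _ /=; ring.
rewrite exchange_big -mulmxA mxE; apply: eq_bigr => b _ /=; rewrite -big_distrr /=; congr (_ * _).
under eq_bigr do rewrite IJ mulmx1 mxE; rewrite exchange_big [RHS]mxE; apply: eq_bigr => a _ /=.
by rewrite ricE -big_distrr /= mxE mulrC.
Qed.

End Naturality.

(** For u = exp (k f) the Hessian is k u (Hess f + k df df). The choice k = m / b makes it absorb
    the quadratic term of the equation, which thereby becomes linear in u. *)
Lemma exp_hessian (K : comNzRingType) (n : nat) (D : 'I_n -> K -> K)
    (g A : 'M[K]_n) (G : 'I_n -> 'M[K]_n) (f u L s a b ib m k q : K) :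
  derivations D -> g^T = g -> A^T = A ->
  (forall i, D i k = 0) -> (forall i, D i u = k * u * D i f) ->
  ib * b = 1 -> k = m * ib -> q = k * a * ib ->
  (forall i j, a * (A + s *: g) i j + b * (D i (D j f) - \sum_l G i j l * D l f)
     + m * (D i f * D j f) = L * g i j) ->
  forall i, map_mx (D i) (\col_j D j u) - G i *m (\col_j D j u) =
    (k * ib * u * L - q * s * u) *: col i g - (q * u) *: col i A.
Proof.
move=> HD gs As k_cst duE bK kE qE E i; apply/matrixP=> j z.
have gC : g j i = g i j by rewrite -{1}gs mxE.
have AC : A j i = A i j by rewrite -{1}As mxE.
rewrite !mxE gC AC.
under [X in _ - X]eq_bigr => l _ do rewrite mxE duE.
have -> : \sum_l G i j l * (k * u * D l f) = k * u * \sum_l G i j l * D l f.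
  by rewrite big_distrr; apply: eq_bigr => l _ /=; ring.
rewrite duE (derivM HD) (derivM HD) k_cst duE.
have := E i j; rewrite !mxE; move: (\sum_l _) => Y E'.
have E2 : D i (D j f) = ib * (L * g i j - a * (A i j + s * g i j) - m * (D i f * D j f)) + Y.
  by rewrite -E' -[LHS]mul1r -bK; ring: bK.
rewrite E2 qE kE.
ring.
Qed.

(** * Positive definite and similar matrices *)

Section PositiveDefinite.
Context {R : rcfType}.

Definition posdef (n : nat) (g : 'M[R]_n) : Prop :=
  forall v : 'rV[R]_n, v != 0 -> 0 < (v *m g *m v^T) 0 0.

Lemma posdef_unitmx n (g : 'M[R]_n) : posdef g -> g \in unitmx.
Proof.
move=> pg; rewrite unitmxE unitfE; apply/negP => /det0P[v v0 vg].
by have := pg v v0; rewrite vg mul0mx mxE ltxx.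
Qed.

Lemma posdef_congr n (g L : 'M[R]_n) : L \in unitmx -> posdef g -> posdef (L *m g *m L^T).
Proof.
move=> uL pg v v0; have := pg (v *m L); rewrite trmx_mul !mulmxA; apply.
by apply: contra v0 => /eqP vL; rewrite -(mulmxK uL v) vL mul0mx.
Qed.

(** Gram-Schmidt by blocks: clear the first row and column, apply the induction hypothesis to the
    Schur complement [S], and normalize the pivot by its square root. *)
Lemma posdef_orthonormal n (g : 'M[R]_n) : g^T = g -> posdef g ->
  exists2 P, P \in unitmx & P *m g *m P^T = 1%:M.
Proof.
elim: n g => [|n IH] g sg pg.
  by exists 1%:M; [exact: unitmx1 | apply/matrixP=> -[]].
rewrite -add1n in g sg pg *.
pose a := ulsubmx g; pose b := ursubmx g; pose D := drsubmx g.
have gE : g = block_mx a b b^T D.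
  by rewrite /b trmx_ursub sg -[LHS]submxK.
have a_gt0 : 0 < a 0 0.
  have := pg (row_mx 1 0); rewrite gE mul_row_block tr_row_mx mul_row_col.
  rewrite !(mul0mx, mul1mx, addr0, trmx1, mulmx1, trmx0, mulmx0); apply.
  by rewrite -[X in _ != X]row_mx0; apply/eqP => /eq_row_mx[/eqP]; rewrite oner_eq0.
have [t aE] : exists t, a = t%:M by exists (a 0 0); rewrite [LHS]mx11_scalar.
have t_gt0 : 0 < t by move: a_gt0; rewrite aE mxE eqxx.
(* One step of symmetric Gaussian elimination with pivot [t]. *)
pose L : 'M[R]_(1 + n) := block_mx 1%:M 0 (- t^-1 *: b^T) 1%:M.
have uL : L \in unitmx by rewrite unitmxE det_lblock !det1 mulr1 unitr1.
pose S := D - t^-1 *: (b^T *m b).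
have LgL : L *m g *m L^T = block_mx a 0 0 S.
  rewrite gE /L mulmx_block tr_block_mx mulmx_block.
  rewrite !(mul0mx, mul1mx, addr0, add0r, trmx1, mulmx1, trmx0, mulmx0).
  have e : - t^-1 *: b^T *m a = - b^T.
    by rewrite aE mul_mx_scalar scalerA mulrN mulfV ?gt_eqF // scaleN1r.
  rewrite e addNr mul0mx add0r linearZ /= trmxK -scalemxAr.
  rewrite aE mul_scalar_mx scalerA mulNr mulVf ?gt_eqF // scaleN1r addNr.
  by congr block_mx; rewrite /S -scalemxAl scaleNr addrC.
have pS : posdef S.
  move=> v v0; have := posdef_congr uL pg; rewrite LgL => /(_ (row_mx 0 v)).
  rewrite mul_row_block tr_row_mx mul_row_col.
  rewrite !(mul0mx, mul1mx, addr0, add0r, trmx1, mulmx1, trmx0, mulmx0); apply.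
  by apply: contra v0; rewrite -[X in _ == X]row_mx0 => /eqP/eq_row_mx[_ ->].
have sS : S^T = S.
  have sD : D^T = D by rewrite /D trmx_drsub sg.
  by rewrite /S linearB linearZ /= trmx_mul trmxK sD.
have [P uP PS] := IH S sS pS.
pose Q : 'M[R]_(1 + n) := block_mx (Num.sqrt t)^-1%:M 0 0 P.
have sqrt0 : Num.sqrt t != 0 by rewrite gt_eqF // sqrtr_gt0.
exists (Q *m L).
  rewrite unitmx_mul uL andbT unitmxE /Q det_lblock unitrM det_scalar1.
  by rewrite -[\det P \is a _]unitmxE uP andbT unitfE invr_neq0.
have -> : Q *m L *m g *m (Q *m L)^T = Q *m (L *m g *m L^T) *m Q^T.
  by rewrite trmx_mul !mulmxA.
rewrite LgL mulmx_block tr_block_mx mulmx_block.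
rewrite !(mul0mx, mul1mx, addr0, add0r, trmx1, mulmx1, trmx0, mulmx0) PS.
rewrite tr_scalar_mx aE -!scalar_mxM [RHS]scalar_mx_block; congr (block_mx _%:M 0 0 1%:M).
by rewrite mulrAC -invfM -expr2 sqr_sqrtr ?ltW // mulVf ?gt_eqF.
Qed.

Lemma sym_trace_sqr_eq0 n (B : 'M[R]_n) : B^T = B -> \tr (B *m B) = 0 -> B = 0.
Proof.
move=> sB trB; apply/matrixP=> i j; rewrite [RHS]mxE.
have : \sum_i \sum_j B i j ^+ 2 = 0.
  rewrite -[RHS]trB; apply: eq_bigr => k _; rewrite mxE; apply: eq_bigr => l _.
  by rewrite -{3}sB mxE expr2.
move=> /eqP; rewrite psumr_eq0 => [/allP/(_ i (mem_index_enum _))/=|k _]; last first.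
  by apply: sumr_ge0 => l _; apply: sqr_ge0.
rewrite psumr_eq0 => [/allP/(_ j (mem_index_enum _))/=|k _]; last exact: sqr_ge0.
by rewrite sqrf_eq0 => /eqP.
Qed.

(** The trace is |A|^2 with respect to [g]. In an orthonormal frame [P] the inverse metric is
    [P^T *m P], and cyclicity turns the trace into that of the square of the symmetric matrix
    [B]. *)
Lemma posdef_trace_eq0 n (g A : 'M[R]_n) : g^T = g -> posdef g -> A^T = A ->
  \tr (invmx g *m A *m (invmx g *m A)) = 0 -> A = 0.
Proof.
move=> sg pg sA; have [P uP PgP] := posdef_orthonormal sg pg.
have ug := posdef_unitmx pg.
have hE : invmx g = P^T *m P.
  have e : g *m (P^T *m P) = 1%:M.
    by rewrite mulmxA; apply: mulmx1C; rewrite mulmxA.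
  by rewrite -[LHS]mulmx1 -e mulKmx.
rewrite hE; set B := P *m A *m P^T.
have -> : \tr (P^T *m P *m A *m (P^T *m P *m A)) = \tr (B *m B).
  by rewrite /B -!mulmxA mxtrace_mulC !mulmxA.
have sB : B^T = B by rewrite /B !trmx_mul trmxK sA mulmxA.
move=> /(sym_trace_sqr_eq0 sB) B0.
have uPT : P^T \in unitmx by rewrite unitmx_tr.
by rewrite -(mulmxK uPT A) -(mulKmx uP (A *m P^T)) [P *m _]mulmxA -/B B0 mulmx0 mul0mx.
Qed.

End PositiveDefinite.

Lemma char_poly_conj (K : fieldType) n (P A : 'M[K]_n) : P \in unitmx ->
  char_poly (P *m A *m invmx P) = char_poly A.
Proof.
move=> uP; have PV : map_mx polyC P *m map_mx polyC (invmx P) = 1%:M.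
  by rewrite -map_mxM mulmxV // map_mx1.
have -> : char_poly (P *m A *m invmx P) =
    \det (map_mx polyC P *m char_poly_mx A *m map_mx polyC (invmx P)).
  congr (\det _); rewrite /char_poly_mx mulmxBr mulmxBl !map_mxM.
  by rewrite scalar_mxC -(mulmxA _%:M) PV mulmx1.
by rewrite !det_mulmx mulrAC -det_mulmx PV det1 mul1r.
Qed.

Lemma mxtrace_conj (K : fieldType) n (P A : 'M[K]_n) : P \in unitmx ->
  \tr (P *m A *m invmx P) = \tr A.
Proof. by move=> uP; rewrite mxtrace_mulC mulmxA mulVmx // mul1mx. Qed.

Local Open Scope classical_set_scope.
Local Open Scope ring_scope.

(** * Calculus on open sets *)

Lemma littleo_differentiable (R : numFieldType) (V W : normedModType R) (f : V -> W)
    (df : {linear V -> W}) (x : V) : continuous df ->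
  (forall e : R, 0 < e -> \forall v \near (0 : V), `|f (v + x) - f x - df v| <= e * `|v|) ->
  differentiable f x.
Proof.
move=> cdf H; suff E : f \o shift x = cst (f x) + df +o_ 0 id.
  by apply/diff_locallyP; rewrite (diff_unique cdf E).
apply/eqaddoP => e /H; apply: filterS => v; congr (`|_| <= _).
by rewrite -addrA -opprD.
Qed.

(** * Continuous partial derivatives imply differentiability *)

Section FirstOrder.
Context {R : realType} {n : nat}.
Implicit Types (h : 'rV[R]_n -> R) (x y e v : 'rV[R]_n) (U : set 'rV[R]_n).

Lemma is_derive_line h y e t : derivable h (y + t *: e) e ->
  is_derive t 1 (fun r : R => h (y + r *: e)) ('D_e h (y + t *: e)).
Proof.
have E : (fun r : R => r^-1 *: (((fun r : R => h (y + r *: e)) \o shift t) (r *: 1) - h (y + t *: e)))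
   = (fun r => r^-1 *: ((h \o shift (y + t *: e)) (r *: e) - h (y + t *: e))).
  apply/funext => r /=; congr (_ *: (h _ - _)).
  by rewrite [_%:A]mulr1 scalerDl addrCA.
by move=> d; split; rewrite /derivable /derive E.
Qed.

(** The mean value theorem on a segment; absolute values in the bounds allow [s] of either sign. *)
Lemma mvt_line h y e (s : R) :
  (forall t : R, `|t| <= `|s| -> derivable h (y + t *: e) e) ->
  exists2 t : R, `|t| <= `|s| & h (y + s *: e) - h y = s * 'D_e h (y + t *: e).
Proof.
move=> dh; pose f (r : R) := h (y + r *: e).
have df (t : R) : `|t| <= `|s| -> is_derive t 1 f ('D_e h (y + t *: e)).
  by move=> /dh; apply: is_derive_line.
have cf (a b : R) : (forall t, t \in `[a, b] -> `|t| <= `|s|) -> {within `[a, b], continuous f}.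
  move=> abs; apply: derivable_within_continuous => t /abs /df dt.
  exact: ex_derive.
have f0 : h y = f 0 by rewrite /f scale0r addr0.
have [s0|s0] := leP 0 s.
- have B t : t \in `[0, s] -> `|t| <= `|s|.
    by rewrite in_itv /= => /andP[t0 ts]; rewrite !ger0_norm.
  have [t ti|t ti E] := @MVT_segment R f (fun t => 'D_e h (y + t *: e)) 0 s s0 _ (cf _ _ B).
    by apply: df; apply: B; apply: subset_itv_oo_cc.
  by exists t; [exact: B | rewrite f0 -/(f s) E subr0 mulrC].
- have B t : t \in `[s, 0] -> `|t| <= `|s|.
    by rewrite in_itv /= => /andP[t0 ts]; rewrite !ler0_norm ?lerN2 // ltW.
  have [t ti|t ti E] := @MVT_segment R f (fun t => 'D_e h (y + t *: e)) s 0 (ltW s0) _ (cf _ _ B).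
    by apply: df; apply: B; apply: subset_itv_oo_cc.
  exists t; first exact: B.
  by rewrite f0 -/(f s) -[LHS]opprB E sub0r mulrN opprK mulrC.
Qed.

Lemma norm_basis (i : 'I_n) : `|basis_vec i : 'rV[R]_n| <= 1.
Proof.
rewrite /basis_vec /Num.norm /= mx_normrE; apply: bigmax_le => // -[a b] _ /=.
by rewrite mxE; case: (_ && _); rewrite ?normr1 ?normr0.
Qed.

Lemma norm_coord v i : `|v 0 i| <= `|v|.
Proof.
rewrite [leRHS]/Num.norm /= mx_normrE.
exact: (le_bigmax _ (fun ij : 'I_1 * 'I_n => `|v ij.1 ij.2|) (0, i)).
Qed.

Section Differentiable.
Variables (U : set 'rV[R]_n) (h : 'rV[R]_n -> R) (x : 'rV[R]_n).
Hypotheses (oU : open U) (Ux : U x).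
Hypothesis dh : forall i y, U y -> derivable h y (basis_vec i).
Hypothesis ch : forall i, {for x, continuous (partial i h)}.

Let L v : R := (v *m (\col_i partial i h x)) 0 0.
Let L_linear : linear L.
Proof. by move=> a u v; rewrite /L mulmxDl -scalemxAl !mxE. Qed.
HB.instance Definition _ := GRing.isLinear.Build R 'rV[R]_n R^o *:%R L L_linear.

Let LE v : L v = \sum_i v 0 i * partial i h x.
Proof. by rewrite /L mxE; apply: eq_bigr => i _; rewrite mxE. Qed.

Let L_continuous : continuous L.
Proof.
have -> : L = \sum_i (fun v => v 0 i * partial i h x).
  by apply/funext => v; rewrite LE fct_sumE.
move=> v; apply: (big_ind (fun f : 'rV[R]_n -> R => {for v, continuous f})).
- exact: cst_continuous.
- by move=> f g cf cg; apply: continuousD.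
- by move=> i _; apply: continuousM; [exact: coord_continuous | exact: cst_continuous].
Qed.

(** Keeps the first k coordinates of [v]. The points [x + head k v] form a path from x to x + v that
    changes one coordinate at a time, so [mvt_line] applies to each step. *)
Let head k v : 'rV[R]_n := \row_i (if (i < k)%N then v 0 i else 0).

Let headS (k : 'I_n) v : head k.+1 v = head k v + v 0 k *: basis_vec k.
Proof.
apply/matrixP=> a b; rewrite !mxE ord1 eqxx /= ltnS leq_eqVlt.
have [->|bk] := eqVneq b k; first by rewrite eqxx ltnn mulr1 add0r.
by rewrite (inj_eq val_inj) (negbTE bk) /= mulr0 addr0.
Qed.

Let increment_bound (eps : R) : 0 < eps -> \forall v \near (0 : 'rV[R]_n),
  `|h (v + x) - h x - L v| <= n%:R * eps * `|v|.
Proof.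
move=> e0.
have : \forall y \near x, U y /\ forall i, `|partial i h x - partial i h y| <= eps.
  have N : \forall y \near x, forall i, `|partial i h x - partial i h y| <= eps.
    apply: (@filter_forall _ 'I_n (fun i y => `|partial i h x - partial i h y| <= eps) (nbhs x)) => i.
    by have /cvgrPdist_le := @ch i; move=> /(_ _ e0).
  by apply: filterS2 (open_nbhs_nbhs (conj oU Ux)) N => y Uy Hy; split.
move=> /nbhs_ballP[d /= d0 dB]; apply/nbhs_ballP; exists d => //= v.
rewrite -ball_normE /= sub0r normrN => vd.
have near_x w : `|w| <= `|v| -> U (x + w) /\ forall i, `|partial i h x - partial i h (x + w)| <= eps.
  by move=> wv; apply: dB; rewrite -ball_normE /= opprD addrA subrr sub0r normrN (le_lt_trans wv).
have step (k : 'I_n) : `|h (x + head k.+1 v) - h (x + head k v) - v 0 k * partial k h x|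
    <= eps * `|v|.
  have seg (t : R) : `|t| <= `|v 0 k| -> `|head k v + t *: basis_vec k| <= `|v|.
    move=> tv; rewrite [leLHS]/Num.norm /= mx_normrE; apply: bigmax_le => // -[a b] _ /=.
    rewrite !mxE ord1 eqxx /=; have [->|bk] := eqVneq b k.
      by rewrite ltnn add0r mulr1 (le_trans tv) ?norm_coord.
    by rewrite mulr0 addr0; case: ifP => _; rewrite ?normr0 ?norm_coord.
  have [|t /seg tv E] := @mvt_line h (x + head k v) (basis_vec k) (v 0 k).
    by move=> t /seg tv; apply: dh; rewrite -addrA; apply: (near_x _ tv).1.
  rewrite headS addrA E -mulrBr normrM mulrC ler_pM ?norm_coord //.
  by rewrite -addrA distrC; apply: (near_x _ tv).2.
have -> : h (v + x) - h x - L v =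
    \sum_(k < n) (h (x + head k.+1 v) - h (x + head k v) - v 0 k * partial k h x).
  rewrite sumrB -LE; congr (_ - _).
  rewrite -(big_mkord xpredT (fun k => h (x + head k.+1 v) - h (x + head k v))).
  rewrite (telescope_sumr (fun k => h (x + head k v))) //.
  have -> : head n v = v by apply/matrixP=> a b; rewrite !mxE ltn_ord ord1.
  have -> : head 0 v = 0 by apply/matrixP=> a b; rewrite !mxE.
  by rewrite addr0 [v + x]addrC.
apply: le_trans (ler_norm_sum _ _ _) _.
apply: le_trans (ler_sum _ (fun k _ => step k)) _.
by rewrite sumr_const card_ord -mulrA mulr_natl.
Qed.

Lemma C1_differentiable : differentiable h x.
Proof.
apply: (@littleo_differentiable R 'rV[R]_n R^o h L x L_continuous) => e e_gt0.
(* The n coordinate steps each cost one such error; n + 1 keeps the denominator positive when n =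
   0. *)
have e0 : 0 < e / (n%:R + 1) by rewrite divr_gt0 // ltr_wpDl.
have := increment_bound e0; apply: filterS => v /= vb.
apply: le_trans vb _.
rewrite ler_wpM2r // mulrCA ler_piMr ?(ltW e_gt0) // ler_pdivrMr ?mul1r ?lerDl //.
Qed.

End Differentiable.

End FirstOrder.

(** * Symmetry of second partial derivatives *)

Section SecondOrder.
Context {R : realType} {n : nat}.
Implicit Types (h : 'rV[R]_n -> R) (x y e v : 'rV[R]_n) (U : set 'rV[R]_n).

Lemma continuous_near h x (eps : R) : {for x, continuous h} -> 0 < eps ->
  \forall y \near x, `|h x - h y| <= eps.
Proof. by move=> /cvgrPdist_le ch e0; apply: ch. Qed.

Lemma is_derive_translate h y e v : derivable h (y + v) e ->
  is_derive y e (fun z => h (z + v)) ('D_e h (y + v)).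
Proof.
have E : (fun r : R => r^-1 *: (((fun z => h (z + v)) \o shift y) (r *: e) - h (y + v)))
   = (fun r => r^-1 *: ((h \o shift (y + v)) (r *: e) - h (y + v))).
  by apply/funext => r /=; rewrite addrA.
by move=> d; split; rewrite /derivable /derive E.
Qed.

Section Schwarz.
Variables (U : set 'rV[R]_n) (h : 'rV[R]_n -> R) (x : 'rV[R]_n).
Hypotheses (oU : open U) (Ux : U x).
Hypothesis dh : forall i y, U y -> derivable h y (basis_vec i).
Hypothesis ddh : forall i j y, U y -> derivable (partial i h) y (basis_vec j).
Hypothesis ch : forall i j, {for x, continuous (partial j (partial i h))}.

(** The mean value theorem twice: first for the increment [k] in direction i, then for [partial i h]
    in direction j. *)
Let mixed_difference i j (s : R) :
  (forall t t' : R, `|t| <= `|s| -> `|t'| <= `|s| -> U (x + t *: basis_vec i + t' *: basis_vec j)) ->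
  exists2 c, exists t t' : R, [/\ `|t| <= `|s|, `|t'| <= `|s| &
      c = partial j (partial i h) (x + t *: basis_vec i + t' *: basis_vec j)] &
    h (x + s *: basis_vec i + s *: basis_vec j) - h (x + s *: basis_vec i)
    - (h (x + s *: basis_vec j) - h x) = s * (s * c).
Proof.
move=> HU; pose k y := h (y + s *: basis_vec j) - h y.
have HU0 (t : R) : `|t| <= `|s| -> U (x + t *: basis_vec i).
  by move=> ts; have := HU t 0 ts; rewrite normr0 scale0r addr0; apply.
have dk (t : R) : `|t| <= `|s| -> is_derive (x + t *: basis_vec i) (basis_vec i) k
   (partial i h (x + t *: basis_vec i + s *: basis_vec j) - partial i h (x + t *: basis_vec i)).
  move=> ts; apply: is_deriveB.
  - by apply: is_derive_translate; apply/dh/HU.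
  - by apply/derivableP/dh/HU0.
have [|t ts E] := @mvt_line R n k x (basis_vec i) s; first by move=> t /dk dt; exact: ex_derive.
have [|t' ts' E'] := @mvt_line R n (partial i h) (x + t *: basis_vec i) (basis_vec j) s.
  by move=> t' ts'; apply/ddh/HU.
exists (partial j (partial i h) (x + t *: basis_vec i + t' *: basis_vec j)); first by exists t, t'.
by rewrite -/(k _) -/(k x) E -E'; have := dk t ts => -[_ ->].
Qed.

Lemma schwarz i j : partial j (partial i h) x = partial i (partial j h) x.
Proof.
apply/eqP; rewrite -subr_eq0 -normr_le0; apply/ler_addgt0Pl => e e0; rewrite addr0.
have e20 : 0 < e / 2 by rewrite divr_gt0.
have N1 := continuous_near (@ch i j) e20; have N2 := continuous_near (@ch j i) e20.
have N := @filterI _ (nbhs x) (nbhs_filter x) _ _ (open_nbhs_nbhs (conj oU Ux)) (@filterI _ (nbhs x) (nbhs_filter x) _ _ N1 N2).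
(* With a third of the radius, two successive displacements of size at most [s] stay inside the
   ball. *)
have [d /= d0 dB] := (@nbhs_ballP R 'rV[R]_n x _).1 N; pose s := d / 3.
have s0 : 0 < s by rewrite divr_gt0.
have B a b (t t' : R) : `|t| <= `|s| -> `|t'| <= `|s| ->
    ball x d (x + t *: basis_vec a + t' *: basis_vec b).
  rewrite (gtr0_norm s0) => ts ts'.
  rewrite -ball_normE /= -addrA opprD addrA subrr sub0r normrN.
  apply: le_lt_trans (ler_normD _ _) _; rewrite !normrZ.
  have H (c : 'I_n) (r : R) : `|r| <= s -> `|r| * `|basis_vec c : 'rV[R]_n| <= s.
    by move=> rs; apply: le_trans rs; rewrite ler_piMr ?norm_basis.
  apply: le_lt_trans (lerD (H a _ ts) (H b _ ts')) _.
  rewrite /s; lra.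
have [|c1 [t1 [t2 [ht1 ht2 c1E]]] E1] := @mixed_difference i j s.
  by move=> *; apply: (dB _ (B _ _ _ _ _ _)).1.
have [|c2 [r1 [r2 [hr1 hr2 c2E]]] E2] := @mixed_difference j i s.
  by move=> *; apply: (dB _ (B _ _ _ _ _ _)).1.
have [_ [b1 _]] := dB _ (B i j _ _ ht1 ht2); have [_ [_ b2]] := dB _ (B j i _ _ hr1 hr2).
(* The second difference over the square does not depend on the order of i and j, so both mixed
   derivatives take a common value at points near x. *)
have : s * (s * c1) = s * (s * c2).
  rewrite -E1 -E2 (addrAC x (s *: basis_vec j)).
  move: (h (_ + _ + _)) (h (x + s *: basis_vec i)) (h (x + s *: basis_vec j)) (h x) => a1 a2 a3 a4.
  ring.
have sn0 : s != 0 by rewrite gt_eqF.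
move=> /(mulfI sn0)/(mulfI sn0) E.
move: b1 b2; rewrite /= -c1E -c2E E => b1 b2.
have close (a b c : R) : `|a - c| <= e / 2 -> `|b - c| <= e / 2 -> `|a - b| <= e.
  move=> ac bc; rewrite -(subrKA c) (splitr e).
  by apply: le_trans (ler_normD _ _) _; rewrite lerD // distrC.
exact: close b1 b2.
Qed.

End Schwarz.

End SecondOrder.

Lemma near_eq_continuous (S T : topologicalType) (f g : S -> T) (x : S) : (\forall y \near x, f y = g y) ->
  {for x, continuous f} -> {for x, continuous g}.
Proof.
move=> fg cf; have fgx : f x = g x := @nbhs_singleton _ x _ fg.
move=> A /=; rewrite -fgx => /cf; rewrite /= /nbhs /=.
move: fg; apply: (@filterS2 _ (nbhs x) (nbhs_filter x)) => y /= -> //.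
Qed.

(** * Closure properties of C^k functions *)

Section Smooth.
Context {R : realType} {n : nat}.
Implicit Types (f g h : 'rV[R]_n -> R) (x y : 'rV[R]_n) (U V : set 'rV[R]_n).

Lemma Ck_continuous k U h x : open U -> Ck_on k U h -> U x -> {for x, continuous h}.
Proof.
move=> oU Ck Ux; have : {within U, continuous h} by case: k Ck => [|k] [].
by rewrite continuous_open_subspace // => /(_ x); apply; rewrite inE.
Qed.

Lemma continuous_within U h : open U -> (forall x, U x -> {for x, continuous h}) ->
  {within U, continuous h}.
Proof. by move=> oU ch; rewrite continuous_open_subspace // => x /set_mem /ch. Qed.

Lemma Ck_pred k U h : Ck_on k.+1 U h -> Ck_on k U h.
Proof.
elim: k h => [|k IH] h; first by case.
by move=> [ch Hh]; split=> // i; have [dh Ch] := Hh i; split=> //; apply: IH.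
Qed.

Lemma near_eq_on U f g x : open U -> U x -> (forall y, U y -> f y = g y) ->
  \forall y \near x, f y = g y.
Proof.
move=> oU Ux fg; have := open_nbhs_nbhs (conj oU Ux).
exact: (@filterS _ (nbhs x) (nbhs_filter x)).
Qed.

Lemma partial_eq_on U f g i x : open U -> U x -> (forall y, U y -> f y = g y) ->
  partial i f x = partial i g x.
Proof. by move=> oU Ux fg; apply: near_eq_derive; apply: near_eq_on fg. Qed.

Lemma Ck_eq k U f g : open U -> (forall x, U x -> f x = g x) ->
  Ck_on k U f -> Ck_on k U g.
Proof.
move=> oU; elim: k f g => [|k IH] f g fg.
  case=> cf _; split=> //; apply: continuous_within => // x Ux.
  apply: near_eq_continuous (near_eq_on oU Ux fg) _.
  exact: (@Ck_continuous 0 U).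
move=> Cf; split.
  apply: continuous_within => // x Ux.
  exact: near_eq_continuous (near_eq_on oU Ux fg) (Ck_continuous oU Cf Ux).
move=> i; have [_ /(_ i)[df Cpf]] := Cf; split.
  by move=> x Ux; apply: near_eq_derivable (df x Ux); apply: near_eq_on fg.
by apply: IH Cpf => x Ux; apply: partial_eq_on fg.
Qed.

Lemma Ck_sub k U V f : open U -> open V -> V `<=` U -> Ck_on k U f -> Ck_on k V f.
Proof.
move=> oU oV VU; elim: k f => [|k IH] f Cf.
  split=> //; apply: continuous_within => // x /VU Ux; exact: (Ck_continuous oU Cf).
split; first by apply: continuous_within => // x /VU Ux; exact: (Ck_continuous oU Cf).
by move=> i; have [_ /(_ i)[df Cpf]] := Cf; split=> [x /VU /df //|]; apply: IH.
Qed.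

Lemma Ck_derivable k U f x i : Ck_on k.+1 U f -> U x -> derivable f x (basis_vec i).
Proof. by move=> [_ /(_ i)[df _]] /df. Qed.

Lemma Ck_partial k U f i : Ck_on k.+1 U f -> Ck_on k U (partial i f).
Proof. by move=> [_ /(_ i)[]]. Qed.

(** Drives the inductions on k below: an explicit formula for the partial derivatives reduces
    C^(k+1) to closure properties at level k. *)
Lemma Ck_succ k U f (f' : 'I_n -> 'rV[R]_n -> R) : open U ->
  (forall x, U x -> {for x, continuous f}) ->
  (forall i x, U x -> is_derive x (basis_vec i) f (f' i x)) ->
  (forall i, Ck_on k U (f' i)) -> Ck_on k.+1 U f.
Proof.
move=> oU cf df Cf'; split; first exact: continuous_within.
move=> i; split=> [x /(df i) dfx|]; first exact: ex_derive.
apply: Ck_eq (Cf' i) => // x /(df i) dfx.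
by rewrite /partial (@derive_val _ _ _ _ _ _ _ dfx).
Qed.

Lemma Ck_is_derive k U f i x : Ck_on k.+1 U f -> U x ->
  is_derive x (basis_vec i) f (partial i f x).
Proof. by move=> Cf Ux; apply: derivableP; exact: Ck_derivable Cf Ux. Qed.

Lemma Ck_differentiable k U f x : open U -> Ck_on k.+1 U f -> U x -> differentiable f x.
Proof.
move=> oU Cf Ux; apply: (C1_differentiable oU Ux) => [i y Uy|i].
  exact: Ck_derivable Cf Uy.
exact: (Ck_continuous oU (Ck_partial i Cf) Ux).
Qed.

Lemma Ck_cst k U c : open U -> Ck_on k U (cst c).
Proof.
move=> oU; elim: k c => [|k IH] c.
  by split=> //; apply: continuous_within => // x _; exact: cst_continuous.
apply: (@Ck_succ _ _ _ (fun _ => cst 0)) => [//|x _|i].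
- exact: cst_continuous.
- exact: IH.
Qed.

Lemma CkD k U f g : open U -> Ck_on k U f -> Ck_on k U g -> Ck_on k U (f \+ g).
Proof.
move=> oU; elim: k f g => [|k IH] f g Cf Cg.
  split=> //; apply: continuous_within => // x Ux.
  by apply: continuousD; [exact: Ck_continuous Cf Ux | exact: Ck_continuous Cg Ux].
apply: (@Ck_succ _ _ _ (fun i => partial i f \+ partial i g)) => [//|x Ux|i x Ux|i].
- by apply: continuousD; [exact: Ck_continuous Cf Ux | exact: Ck_continuous Cg Ux].
- by apply: is_deriveD; [exact: Ck_is_derive Cf Ux | exact: Ck_is_derive Cg Ux].
- by apply: IH; exact: Ck_partial.
Qed.

Lemma CkM k U f g : open U -> Ck_on k U f -> Ck_on k U g -> Ck_on k U (f \* g).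
Proof.
move=> oU; elim: k f g => [|k IH] f g Cf Cg.
  split=> //; apply: continuous_within => // x Ux.
  by apply: continuousM; [exact: Ck_continuous Cf Ux | exact: Ck_continuous Cg Ux].
apply: (@Ck_succ _ _ _ (fun i => (f \* partial i g) \+ (g \* partial i f))) => [//|x Ux|i x Ux|i].
- by apply: continuousM; [exact: Ck_continuous Cf Ux | exact: Ck_continuous Cg Ux].
- by apply: is_deriveM; [exact: Ck_is_derive Cf Ux | exact: Ck_is_derive Cg Ux].
- by apply: CkD => //; apply: IH; try exact: Ck_pred; exact: Ck_partial.
Qed.

Lemma CkV k U f : open U -> (forall x, U x -> f x != 0) -> Ck_on k U f ->
  Ck_on k U (fun x => (f x)^-1).
Proof.
move=> oU f0; elim: k => [|k IH] Cf.
  split=> //; apply: continuous_within => // x Ux.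
  by apply: continuousV; [exact: f0 | exact: Ck_continuous Cf Ux].
apply: (@Ck_succ _ _ _ (fun i => cst (-1) \* (((fun x => (f x)^-1) \* (fun x => (f x)^-1)) \* partial i f))) => [//|x Ux|i x Ux|i].
- by apply: continuousV; [exact: f0 | exact: Ck_continuous Cf Ux].
- have dfx : derivable f x (basis_vec i) := Ck_derivable Cf Ux; split; first exact: derivableV (f0 x Ux) dfx.
  rewrite (deriveV (f0 x Ux) dfx) /= /partial mulN1r -mulNr; congr (_ * _).
  by rewrite -exprVn expr2.
- apply: CkM; [by []|exact: Ck_cst|apply: CkM => //; last exact: Ck_partial].
  by apply: CkM => //; apply: IH; exact: Ck_pred.
Qed.

Lemma Ck_expR k U f : open U -> Ck_on k U f -> Ck_on k U (fun x => expR (f x)).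
Proof.
move=> oU; elim: k => [|k IH] Cf.
  split=> //; apply: continuous_within => // x Ux.
  by apply: continuous_comp; [exact: Ck_continuous Cf Ux | exact: continuous_expR].
apply: (@Ck_succ _ _ _ (fun i => (fun x => expR (f x)) \* partial i f)) => [//|x Ux|i x Ux|i].
- by apply: continuous_comp; [exact: Ck_continuous Cf Ux | exact: continuous_expR].
- have dfx := Ck_differentiable oU Cf Ux.
  have dexp : differentiable (@expR R) (f x) by apply/derivable1_diffP/derivable_expR.
  have dc : differentiable (expR \o f) x by apply: differentiable_comp.
  split; first exact: diff_derivable.
  rewrite deriveE // diff_comp //= (deriv1E (@derivable_expR _ _)) /= derive1E derive_val.
  by rewrite /partial deriveE // [RHS]mulrC.
- by apply: CkM => //; [apply: IH; exact: Ck_pred | exact: Ck_partial].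
Qed.

End Smooth.

Section Composition.
Context {R : realType} {n : nat}.
Implicit Types (f g h : 'rV[R]_n -> R) (x y : 'rV[R]_n) (U V : set 'rV[R]_n).
Implicit Type F : 'rV[R]_n -> 'rV[R]_n.

Lemma row_sum_coord F : F = \sum_i (fun y => F y 0 i *: (delta_mx 0 i : 'rV[R]_n)).
Proof. by apply/funext => y; rewrite fct_sumE {1}(row_sum_delta (F y)). Qed.

Lemma differentiable_row F x : (forall i, differentiable (fun y => F y 0 i) x) ->
  differentiable F x.
Proof.
move=> dF; rewrite (row_sum_coord F); apply: differentiable_sum => i.
exact: differentiableZl.
Qed.

Lemma continuous_row F x : (forall i, {for x, continuous (fun y => F y 0 i)}) ->
  {for x, continuous F}.
Proof.
move=> cF; rewrite (row_sum_coord F).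
apply: (big_ind (fun f : 'rV[R]_n -> 'rV[R]_n => {for x, continuous f})).
- exact: cst_continuous.
- by move=> f g cf cg; apply: continuousD.
- by move=> i _; apply: continuousZ; [exact: cF | exact: cst_continuous].
Qed.

Lemma jacobianE F x i j : differentiable F x ->
  'J F x i j = partial i (fun y => F y 0 j) x.
Proof.
move=> dF; have := deriveEjacobian (basis_vec i) dF.
rewrite derive_mx; last exact: diff_derivable.
move=> /(congr1 (fun A : 'rV[R]_n => A 0 j)); rewrite mxE /partial => ->.
by rewrite /basis_vec -rowE [RHS]mxE.
Qed.

Lemma partial_comp F h x i : differentiable F x -> differentiable h (F x) ->
  is_derive x (basis_vec i) (h \o F)
    (\sum_a partial i (fun y => F y 0 a) x * partial a h (F x)).
Proof.
move=> dF dh; have dc : differentiable (h \o F) x by apply: differentiable_comp.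
split; first exact: diff_derivable.
have E : 'd F x (basis_vec i) = basis_vec i *m 'J F x by rewrite -deriveE // deriveEjacobian.
rewrite deriveE // diff_comp //= E.
rewrite /basis_vec -rowE (row_sum_delta (row i _)) linear_sum; apply: eq_bigr => a _ /=.
by rewrite linearZ /= -deriveE // [row i _ _ _]mxE jacobianE.
Qed.

Lemma Ck_comp k U V F h : open U -> open V -> (forall x, U x -> V (F x)) ->
  (forall i, Ck_on k U (fun y => F y 0 i)) -> Ck_on k V h -> Ck_on k U (h \o F).
Proof.
move=> oU oV FUV; elim: k h => [|k IH] h CF Ch.
  split=> //; apply: continuous_within => // x Ux; apply: continuous_comp.
    by apply: continuous_row => i; apply: Ck_continuous (CF i) Ux.
  by apply: Ck_continuous Ch _ => //; apply: FUV.
apply: (@Ck_succ _ _ _ _ _ (fun i x => \sum_a partial i (fun y => F y 0 a) x * partial a h (F x)))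
  => [//|x Ux|i x Ux|i].
- apply: continuous_comp; last by apply: Ck_continuous Ch _ => //; apply: FUV.
  by apply: continuous_row => i; apply: Ck_continuous (CF i) Ux.
- apply: partial_comp; last by apply: Ck_differentiable Ch _ => //; apply: FUV.
  by apply: differentiable_row => a; apply: Ck_differentiable (CF a) Ux.
- have -> : (fun x => \sum_a partial i (fun y => F y 0 a) x * partial a h (F x)) =
      \sum_a (partial i (fun y => F y 0 a) \* (partial a h \o F)).
    by apply/funext => x; rewrite fct_sumE.
  apply: (big_ind (Ck_on k U)).
  + exact: Ck_cst.
  + by move=> f g; apply: CkD.
  + move=> a _; apply: CkM => //; first exact: Ck_partial.
    by apply: IH => [i'|]; [exact/Ck_pred/CF | exact: Ck_partial].
Qed.

End Composition.

(** * The ring of smooth functions on an open set *)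

Lemma smooth_partialC (R : realType) (n : nat) (U : set 'rV[R]_n) h x i j :
  open U -> U x -> smooth_on U h -> partial j (partial i h) x = partial i (partial j h) x.
Proof.
move=> oU Ux sh; apply: (@schwarz R n U h x oU Ux) => [a y Uy|a b y Uy|a b].
- exact: Ck_derivable (sh 1%N) Uy.
- by apply: Ck_derivable Uy; apply: Ck_partial; exact: (sh 2%N).
- by apply: Ck_continuous Ux => //; do 2!apply: Ck_partial; exact: (sh 2%N).
Qed.

(** Nonemptiness gives 1 != 0 in the ring of smooth functions on the set. *)
Record domain (R : realType) (n : nat) := Domain {
  domain_set :> 'rV[R]_n -> Prop;
  domain_open : open (domain_set : set 'rV[R]_n);
  domain_nonempty : exists x, domain_set x }.

Arguments domain_open {R n} d : rename.

(* Smooth functions on [U], extended by zero so that equality on [U] is Leibniz equality. *)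
Record sfun (R : realType) (n : nat) (U : domain R n) := SFun {
  sfun_val :> 'rV[R]_n -> R;
  sfun_smooth : smooth_on U sfun_val;
  sfun_out : forall x, ~ U x -> sfun_val x = 0 }.

Section SmoothRing.
Context {R : realType} {n : nat} {U : domain R n}.
Implicit Types (f g : sfun U) (h : 'rV[R]_n -> R).

Lemma sfunP f g : (forall x, U x -> f x = g x) -> f = g.
Proof.
case: f g => [f sf f0] [g sg g0] /= fg.
have E : f = g.
  by apply/funext => x; have [/fg//|nUx] := pselect (U x); rewrite f0 ?g0.
by case: _ / E sg g0 {fg} => sg g0; congr SFun; exact: Prop_irrelevance.
Qed.

Definition extend0 h x := if `[< U x >] then h x else 0.

Lemma extend0E h x : U x -> extend0 h x = h x.
Proof. by rewrite /extend0 => Ux; case: asboolP. Qed.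

Lemma extend0_smooth h : smooth_on U h -> smooth_on U (extend0 h).
Proof.
move=> sh k; apply: Ck_eq (sh k); first exact: (domain_open U).
by move=> x Ux; rewrite extend0E.
Qed.

Lemma extend0_out h x : ~ U x -> extend0 h x = 0.
Proof. by rewrite /extend0 => Ux; case: asboolP. Qed.

Definition mk_sfun h (sh : smooth_on U h) : sfun U :=
  SFun (extend0_smooth sh) (@extend0_out h).

Lemma mk_sfunE h (sh : smooth_on U h) x : U x -> mk_sfun sh x = h x.
Proof. exact: extend0E. Qed.

HB.instance Definition _ := gen_eqMixin (sfun U).
HB.instance Definition _ := gen_choiceMixin (sfun U).

Lemma smooth_cst c : smooth_on U (cst c).
Proof. by move=> k; apply: Ck_cst; exact: (domain_open U). Qed.
Lemma smooth_add f g : smooth_on U (f \+ g).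
Proof. by move=> k; apply: CkD; [exact: (domain_open U)|exact: sfun_smooth..]. Qed.
Lemma smooth_mul f g : smooth_on U (f \* g).
Proof. by move=> k; apply: CkM; [exact: (domain_open U)|exact: sfun_smooth..]. Qed.
Lemma smooth_opp f : smooth_on U (cst (-1) \* f).
Proof.
by move=> k; apply: CkM; [exact: (domain_open U)|exact: smooth_cst|exact: sfun_smooth].
Qed.

Definition sfun_cst c := mk_sfun (smooth_cst c).
Definition sfun_add f g := mk_sfun (smooth_add f g).
Definition sfun_mul f g := mk_sfun (smooth_mul f g).
Definition sfun_opp f := mk_sfun (smooth_opp f).

Let cstE c x : U x -> sfun_cst c x = c. Proof. exact: extend0E. Qed.
Let addE f g x : U x -> sfun_add f g x = f x + g x. Proof. exact: extend0E. Qed.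
Let mulE f g x : U x -> sfun_mul f g x = f x * g x. Proof. exact: extend0E. Qed.
Let oppE f x : U x -> sfun_opp f x = - f x.
Proof. by move=> Ux; rewrite -mulN1r; exact: extend0E. Qed.
Let opE := (cstE, addE, mulE, oppE).


Fact sfun_addA : associative sfun_add.
Proof. by move=> f g k; apply: sfunP => x Ux; rewrite !opE //; rewrite addrA. Qed.
Fact sfun_addC : commutative sfun_add.
Proof. by move=> f g; apply: sfunP => x Ux; rewrite !opE //; rewrite addrC. Qed.
Fact sfun_add0 : left_id (sfun_cst 0) sfun_add.
Proof. by move=> f; apply: sfunP => x Ux; rewrite !opE //; rewrite add0r. Qed.
Fact sfun_addN : left_inverse (sfun_cst 0) sfun_opp sfun_add.
Proof. by move=> f; apply: sfunP => x Ux; rewrite !opE //; rewrite addNr. Qed.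
Fact sfun_mulA : associative sfun_mul.
Proof. by move=> f g k; apply: sfunP => x Ux; rewrite !opE //; rewrite mulrA. Qed.
Fact sfun_mulC : commutative sfun_mul.
Proof. by move=> f g; apply: sfunP => x Ux; rewrite !opE //; rewrite mulrC. Qed.
Fact sfun_mul1 : left_id (sfun_cst 1) sfun_mul.
Proof. by move=> f; apply: sfunP => x Ux; rewrite !opE //; rewrite mul1r. Qed.
Fact sfun_mulD : left_distributive sfun_mul sfun_add.
Proof. by move=> f g k; apply: sfunP => x Ux; rewrite !opE //; rewrite mulrDl. Qed.
Fact sfun_1neq0 : sfun_cst 1 != sfun_cst 0.
Proof.
apply/eqP => E; have [x Ux] := domain_nonempty U.
have := congr1 (fun f : sfun U => f x) E.
by rewrite !opE // => /eqP; rewrite oner_eq0.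
Qed.

HB.instance Definition _ := GRing.isZmodule.Build (sfun U)
  sfun_addA sfun_addC sfun_add0 sfun_addN.
HB.instance Definition _ := GRing.Zmodule_isComNzRing.Build (sfun U)
  sfun_mulA sfun_mulC sfun_mul1 sfun_mulD sfun_1neq0.

Lemma sfunDE f g x : U x -> (f + g) x = f x + g x. Proof. exact: addE. Qed.
Lemma sfunME f g x : U x -> (f * g) x = f x * g x. Proof. exact: mulE. Qed.

Section Evaluation.
Context (x : 'rV[R]_n) (Ux : U x).

(** The membership proof is kept in the term because evaluation is a ring morphism only at points of
    [U]; elsewhere it sends 1 to 0. *)
Definition seval f : R := let _ := Ux in f x.

Arguments seval : simpl never.
Fact seval_additive : zmod_morphism seval.
Proof. by move=> f g; rewrite /seval -[f - g]/(sfun_add f (sfun_opp g)) !opE. Qed.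
Fact seval_multiplicative : monoid_morphism seval.
Proof. by split=> [|f g]; [exact: cstE | exact: mulE]. Qed.
HB.instance Definition _ := GRing.isZmodMorphism.Build (sfun U) R seval seval_additive.
HB.instance Definition _ := GRing.isMonoidMorphism.Build (sfun U) R seval seval_multiplicative.

Lemma seval_mk h (sh : smooth_on U h) : seval (mk_sfun sh) = h x.
Proof. exact: mk_sfunE. Qed.
Lemma seval_cst c : seval (sfun_cst c) = c. Proof. exact: mk_sfunE. Qed.

End Evaluation.
#[local] Arguments seval : simpl never.

Lemma seval_inj f g : (forall x (Ux : U x), seval Ux f = seval Ux g) -> f = g.
Proof. exact: sfunP. Qed.

Lemma sfun_two_regular f : f + f = 0 -> f = 0.
Proof.
move=> ff; apply: seval_inj => x Ux; have := congr1 (seval Ux) ff.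
by rewrite !raddfD !raddf0 => /eqP; rewrite -mulr2n mulrn_eq0 /= => /eqP.
Qed.

Lemma sfun_cst_regular c f : c != 0 -> sfun_cst c * f = 0 -> f = 0.
Proof.
move=> c0 cf; apply: seval_inj => x Ux; have := congr1 (seval Ux) cf.
by rewrite rmorphM !raddf0 /= seval_cst => /eqP; rewrite mulf_eq0 (negbTE c0) => /eqP.
Qed.

Lemma smooth_partial i h : smooth_on U h -> smooth_on U (partial i h).
Proof. by move=> sh k; apply: Ck_partial (sh k.+1). Qed.

Definition sderiv i f : sfun U := mk_sfun (smooth_partial i (sfun_smooth f)).

Lemma sderivE i f x (Ux : U x) : sderiv i f x = partial i f x.
Proof. exact: mk_sfunE. Qed.

Lemma sderiv_mk i h (sh : smooth_on U h) x : U x -> sderiv i (mk_sfun sh) x = partial i h x.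
Proof.
move=> Ux; rewrite sderivE //.
by apply: (partial_eq_on _ (domain_open U) Ux) => y; exact: mk_sfunE.
Qed.

Lemma sderiv_cst i c : sderiv i (sfun_cst c) = 0.
Proof.
apply: sfunP => x Ux; rewrite sderiv_mk // [RHS]mk_sfunE //.
by rewrite /partial derive_cst.
Qed.

Lemma sderiv_derivations : derivations sderiv.
Proof.
have df i f x : U x -> derivable f x (basis_vec i).
  by move=> Ux; apply: (@Ck_derivable _ _ 0 U); [exact: sfun_smooth|].
split=> [i f g|i f g|i j f]; apply: sfunP => x Ux.
- rewrite sderiv_mk // sfunDE // !sderivE //.
  by rewrite /partial deriveD //; exact: df.
- rewrite sderiv_mk // sfunDE // !sfunME // !sderivE //.
  by rewrite /partial deriveM; [rewrite addrC [X in X + _]mulrC|exact: df..].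
- have E a b : sderiv a (sderiv b f) x = partial a (partial b f) x by exact: sderiv_mk.
  refine (etrans (E i j) (etrans _ (esym (E j i)))).
  exact: (smooth_partialC j i (domain_open U) Ux (sfun_smooth f)).
Qed.

End SmoothRing.
Arguments seval : simpl never.
Arguments mk_sfun : simpl never.
Arguments sfun_cst : simpl never.
Arguments sderiv : simpl never.

(** * Pullback of smooth functions and the chain rule *)

Section Pullback.
Context {R : realType} {n : nat} {U V : domain R n} (F : 'rV[R]_n -> 'rV[R]_n).
Hypothesis FUV : forall x, U x -> V (F x).
Hypothesis F_smooth : forall i, smooth_on U (fun x => F x 0 i).

Lemma smooth_comp (f : sfun V) : smooth_on U (f \o F).
Proof.
move=> k; apply: (@Ck_comp _ _ k U V F f (domain_open U) (domain_open V) FUV).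
- by move=> i; exact: F_smooth.
- exact: sfun_smooth.
Qed.

Definition pull (f : sfun V) : sfun U := mk_sfun (smooth_comp f).

Arguments pull : simpl never.

Lemma pullE f x : U x -> pull f x = f (F x). Proof. exact: mk_sfunE. Qed.

Lemma seval_pull f x (Ux : U x) : seval Ux (pull f) = seval (FUV Ux) f.
Proof. exact: pullE. Qed.

Fact pull_additive : zmod_morphism pull.
Proof.
move=> f g; apply: seval_inj => x Ux.
by rewrite [RHS]raddfB /= !seval_pull raddfB.
Qed.
Fact pull_multiplicative : monoid_morphism pull.
Proof.
split=> [|f g]; apply: seval_inj => x Ux.
  by rewrite seval_pull !rmorph1.
by rewrite [RHS]rmorphM /= !seval_pull rmorphM.
Qed.
HB.instance Definition _ := GRing.isZmodMorphism.Build (sfun V) (sfun U) pull pull_additive.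
HB.instance Definition _ := GRing.isMonoidMorphism.Build (sfun V) (sfun U) pull pull_multiplicative.

Definition sjac : 'M[sfun U]_n :=
  \matrix_(i, j) sderiv i (mk_sfun (@F_smooth j)).

Lemma differentiable_smooth_map x : U x -> differentiable F x.
Proof.
move=> Ux; apply: differentiable_row => i.
exact: (Ck_differentiable (domain_open U) (@F_smooth i 1%N) Ux).
Qed.

Lemma seval_sjac x (Ux : U x) : map_mx (seval Ux) sjac = 'J F x.
Proof.
apply/matrixP=> i j; rewrite [LHS]mxE [sjac _ _]mxE jacobianE; last exact: differentiable_smooth_map.
by rewrite /seval sderiv_mk.
Qed.

Lemma sjac_closed i j a : sderiv i (sjac j a) = sderiv j (sjac i a).
Proof. by rewrite !mxE (derivC (@sderiv_derivations R n U)). Qed.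

Lemma sderiv_pull i f : sderiv i (pull f) = \sum_a sjac i a * pull (sderiv a f).
Proof.
apply: seval_inj => x Ux; rewrite raddf_sum /= {1}/seval sderiv_mk //.
have df : differentiable f (F x).
  exact: (Ck_differentiable (domain_open V) (sfun_smooth f 1%N) (FUV Ux)).
rewrite /partial (@derive_val _ _ _ _ _ _ _ (partial_comp i (differentiable_smooth_map Ux) df)).
apply: eq_bigr => a _; rewrite rmorphM /= seval_pull /seval sderivE; last exact: FUV.
by rewrite mxE sderiv_mk.
Qed.

End Pullback.
Arguments pull : simpl never.

(** * Riemannian metrics in charts *)

Section LocalMetric.
Context {R : realType} {n : nat} {M : riemannianManifold R n} {c : chart R n M}.
Hypothesis ac : atlas c.
Context {U : domain R n}.
Hypothesis UI : forall x, U x -> img c x.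

Lemma smooth_restrict h : smooth_on (img c) h -> smooth_on U h.
Proof.
by move=> sh k; apply: Ck_sub (sh k); [exact: img_open|exact: (domain_open U)|exact: UI].
Qed.

Definition smetric : 'M[sfun U]_n :=
  \matrix_(i, j) mk_sfun (smooth_restrict (@metric_smooth _ _ M c ac i j)).

Lemma seval_smetric x (Ux : U x) : map_mx (seval Ux) smetric = metric c x.
Proof. by apply/matrixP=> i j; rewrite !mxE seval_mk. Qed.

Lemma metric_posdef_at x : img c x -> posdef (metric c x).
Proof. exact: metric_posdef. Qed.

Lemma smetric_sym : smetric^T = smetric.
Proof.
apply/matrixP=> i j; apply: seval_inj => x Ux.
have := Defs.metric_sym ac (UI Ux); rewrite -(seval_smetric Ux) => /matrixP/(_ i j).
by rewrite !mxE.
Qed.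

Lemma smetric_det x : U x -> (\det smetric) x != 0.
Proof.
move=> Ux; rewrite -[_ x]/(seval Ux _) -det_map_mx seval_smetric -unitfE -unitmxE.
exact/posdef_unitmx/metric_posdef_at/UI.
Qed.

Lemma smooth_det_inv : smooth_on U (fun x => ((\det smetric) x)^-1).
Proof.
move=> k; apply: CkV; [exact: (domain_open U)|exact: smetric_det|exact: sfun_smooth].
Qed.

(** Cramer's rule: the entries are visibly smooth because the determinant has no zero on [U]. *)
Definition smetric_inv : 'M[sfun U]_n := mk_sfun smooth_det_inv *: \adj smetric.

Lemma smetricK : smetric *m smetric_inv = 1%:M.
Proof.
rewrite -scalemxAr mul_mx_adj scale_scalar_mx; congr (_%:M).
apply: seval_inj => x Ux; rewrite rmorphM rmorph1 /= seval_mk mulVf //.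
exact: smetric_det.
Qed.

Lemma seval_smetric_inv x (Ux : U x) : map_mx (seval Ux) smetric_inv = metric_inv c x.
Proof.
have := congr1 (map_mx (seval Ux)) smetricK.
rewrite map_mxM map_mx1 seval_smetric => e.
rewrite /metric_inv -[RHS]mulmx1 -e mulKmx //.
exact/posdef_unitmx/metric_posdef_at/UI.
Qed.

Definition schristoffel : 'I_n -> 'M[sfun U]_n :=
  koszul sderiv (sfun_cst 2^-1) smetric smetric_inv.

Lemma seval_sderiv_metric x (Ux : U x) i j l :
  seval Ux (sderiv i (smetric j l)) = partial i (fun y => metric c y j l) x.
Proof. by rewrite mxE /seval sderiv_mk. Qed.

Lemma seval_schristoffel x (Ux : U x) i j k :
  seval Ux (schristoffel i j k) = christoffel c k i j x.
Proof.
rewrite mxE rmorphM /= seval_cst raddf_sum; congr (_ * _); apply: eq_bigr => l _.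
rewrite /= rmorphM raddfB raddfD /= !seval_sderiv_metric -seval_smetric_inv.
by rewrite [in RHS]mxE.
Qed.

Lemma schristoffel_levi_civita : levi_civita sderiv smetric schristoffel.
Proof.
apply: koszul_levi_civita; [|exact: smetric_sym|exact: smetricK].
by apply: seval_inj => x Ux; rewrite raddfD rmorph1 /= seval_cst; lra.
Qed.

Lemma seval_ricci x (Ux : U x) : map_mx (seval Ux) (ric sderiv schristoffel) = ricci c x.
Proof.
have dE i j k l : seval Ux (sderiv i (schristoffel j k l)) = partial i (christoffel c l j k) x.
  rewrite /seval sderivE //; apply: (partial_eq_on _ (domain_open U) Ux) => y Uy.
  exact: (seval_schristoffel Uy).
apply/matrixP=> j k; rewrite [LHS]mxE [RHS]mxE.
exact: (rmorph_ric j k dE (seval_schristoffel Ux)).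
Qed.

End LocalMetric.

Lemma seval_mx_inj (R : realType) (n m p : nat) (U : domain R n) (A B : 'M[sfun U]_(m, p)) :
  (forall x (Ux : U x), map_mx (seval Ux) A = map_mx (seval Ux) B) -> A = B.
Proof.
move=> AB; apply/matrixP=> i j; apply: seval_inj => x Ux.
by have /matrixP/(_ i j) := AB x Ux; rewrite [LHS]mxE [RHS]mxE.
Qed.

(** * The Ricci tensor under isometries *)

Section Naturality.
Context {R : realType} {n : nat} {M : riemannianManifold R n} {c d : chart R n M}.
Hypotheses (ac : atlas c) (ad : atlas d).
Context {phi : M -> M}.
Hypothesis phi_continuous : continuous phi.
Hypothesis phi_smooth : smooth_in_charts phi c d.
Hypothesis phi_metric : forall x, local_dom phi c d x ->
  metric c x = pullback_mx (local_map phi c d) (metric d (local_map phi c d x)) x.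

Lemma local_dom_open : open (local_dom phi c d).
Proof.
have oV : open (phi @^-1` dom d) by move/continuousP: phi_continuous; apply; exact: dom_open.
have := @cinv_continuous _ _ _ c; rewrite continuous_open_subspace; last exact: img_open.
by move=> /(continuous_inP (cinv c) (@img_open _ _ _ c))/(_ _ oV).
Qed.

(** [ricci_pullback] for the rings of smooth functions on [local_dom phi c d] and [img d], with
    composition by the local expression of [phi] as the morphism, evaluated at x. *)
Lemma ricci_natural x : local_dom phi c d x ->
  let J := 'J (local_map phi c d) x in
  ricci c x = J *m ricci d (local_map phi c d x) *m J^T.
Proof.
move=> Ux J.
pose U := @Domain R n (local_dom phi c d) local_dom_open (ex_intro _ x Ux).
have FUV y : U y -> img d (local_map phi c d y).
  by move=> [_ dy]; exists (phi (cinv c y)).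
pose V := @Domain R n (img d) (@img_open _ _ _ d) (ex_intro _ _ (FUV x Ux)).
have UI y : U y -> img c y by case.
have VI y : V y -> img d y by [].
have FUV' : forall y, U y -> V (local_map phi c d y) := FUV.
pose F := @pull R n U V (local_map phi c d) FUV' phi_smooth.
pose Js := @sjac R n U (local_map phi c d) phi_smooth.
have sJ y (Uy : U y) : map_mx (seval Uy) Js = 'J (local_map phi c d) y.
  exact: seval_sjac.
have sF y (Uy : U y) (A : 'M[sfun V]_n) :
    map_mx (seval Uy) (map_mx F A) = map_mx (seval (FUV' y Uy)) A.
  by apply/matrixP=> i j; rewrite [LHS]mxE [X in seval Uy X]mxE [RHS]mxE; exact: seval_pull.
have gp : smetric ac UI = Js *m map_mx F (smetric ad VI) *m Js^T.
  apply: seval_mx_inj => y Uy.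
  rewrite !map_mxM -map_trmx sJ sF !seval_smetric.
  exact: phi_metric.
have := @ricci_pullback _ _ n _ _ (@sderiv_derivations R n U)
  (@sfun_two_regular R n U) F Js (@sderiv_pull R n U V (local_map phi c d) FUV' phi_smooth)
  (@sjac_closed R n U (local_map phi c d) phi_smooth)
  _ _ _ _ _ (smetricK ac UI) (smetric_sym ad VI) gp
  (schristoffel_levi_civita ac UI) (schristoffel_levi_civita ad VI).
move=> /(congr1 (map_mx (seval (U := U) Ux))).
by rewrite !map_mxM -map_trmx sJ sF !seval_ricci.
Qed.

End Naturality.

Section Homogeneous.
Context {R : realType} {n : nat} {M : riemannianManifold R n}.

Definition ricci_endo (c : chart R n M) x : 'M[R]_n := metric_inv c x *m ricci c x.

Lemma trace_ricci_endo c x : atlas c -> img c x ->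
  \tr (ricci_endo c x) = scalar_curvature c x.
Proof.
move=> ac cx; have ug : metric c x \in unitmx by apply/posdef_unitmx/metric_posdef_at.
have hs : (metric_inv c x)^T = metric_inv c x by rewrite /metric_inv trmx_inv Defs.metric_sym.
rewrite /scalar_curvature exchange_big; apply: eq_bigr => j _; rewrite [LHS]mxE.
by apply: eq_bigr => i _; rewrite -{1}hs mxE.
Qed.

(** An isometry carrying one point to the other gives g = J g' J^T and Ric = J Ric' J^T with the
    same [J]. Hence g^-1 Ric is conjugated by the inverse transpose of [J]. *)
Lemma ricci_endo_conj (c d : chart R n M) (x y : 'rV[R]_n) :
  homogeneous M -> atlas c -> atlas d -> img c x -> img d y ->
  exists2 P, P \in unitmx & ricci_endo c x = P *m ricci_endo d y *m invmx P.
Proof.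
move=> homM ac ad cx dy; have [p dp px] := cx; have [q dq qy] := dy.
have [phi [[phi_cont phi_smooth] _ phi_metric] phipq] := homM p q.
have cxp : cinv c x = p by rewrite -px cmapK.
have lx : local_dom phi c d x by split=> //; rewrite cxp phipq.
have ly : local_map phi c d x = y by rewrite /local_map cxp phipq.
have := ricci_natural ac ad phi_cont (phi_smooth c d ac ad) (phi_metric c d ac ad) lx.
have := phi_metric c d ac ad x lx; rewrite /pullback_mx ly.
move: ('J _ x) => J gE ricE.
have ug : metric c x \in unitmx by apply/posdef_unitmx/metric_posdef_at.
have ug' : metric d y \in unitmx by apply/posdef_unitmx/metric_posdef_at.
have uJ : J \in unitmx by move: ug; rewrite gE !unitmx_mul => /andP[/andP[]].
have uJT : J^T \in unitmx by rewrite unitmx_tr.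
exists (invmx J^T); first by rewrite unitmx_inv.
rewrite invmxK /ricci_endo /metric_inv ricE.
have -> : invmx (metric c x) = invmx J^T *m invmx (metric d y) *m invmx J.
  apply: (can_inj (mulKmx ug)); rewrite mulmxV // gE.
  by rewrite -!mulmxA (mulKVmx uJT) (mulKVmx ug') mulmxV.
by rewrite !mulmxA mulmxKV.
Qed.

End Homogeneous.

(** * Gradient Einstein-type manifolds *)

(* In the notation of the header, [exp_potential f (exp_rate beta mu)] is u,
   [ricci_coef alpha beta mu] is q, [mean_ricci n S] is S / n and [tracefree_ricci] is A. *)
Definition exp_rate {R : realType} (beta mu : R) : R := mu / beta.
Definition ricci_coef {R : realType} (alpha beta mu : R) : R := exp_rate beta mu * alpha / beta.
Definition mean_ricci {R : realType} (n : nat) (S : R) : R := S / n%:R.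

Section Potential.
Context {R : realType} {n : nat} {M : riemannianManifold R n}.

Definition exp_potential (f : M -> R) (k : R) (p : M) : R := expR (k * f p).

Definition exp_differential (f : M -> R) (k : R) (c : chart R n M) x : 'cV[R]_n :=
  \col_i partial i (fun y => exp_potential f k (cinv c y)) x.

Definition tracefree_ricci (s : R) (c : chart R n M) x : 'M[R]_n :=
  ricci c x - s *: metric c x.
End Potential.

Section LocalEinsteinType.
Context {R : realType} {n : nat} {M : riemannianManifold R n}.
Context {f lambda : M -> R} {alpha beta mu rho S : R}.
Hypothesis n_ge3 : (3 <= n)%N.
Hypothesis einstein_type : gradient_einstein_type f lambda alpha beta mu rho.
Hypothesis nondegenerate : nondegenerate_constants n alpha beta mu.
Hypothesis mu_neq0 : mu <> 0.
Hypothesis alpha_neq0 : alpha <> 0.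
Hypothesis beta2 : beta ^+ 2 <> - (mu * alpha).
Context {c : chart R n M}.
Hypothesis ac : atlas c.
Hypothesis scalar_cst : forall x, img c x -> scalar_curvature c x = S.

Let beta0 : beta != 0. Proof. by apply/eqP; case: nondegenerate. Qed.
Let n0 : n%:R != 0 :> R.
Proof. by rewrite pnatr_eq0 -lt0n; apply: leq_trans n_ge3. Qed.


Local Notation kap := (exp_rate beta mu).
Local Notation qc := (ricci_coef alpha beta mu).
Local Notation sc := (mean_ricci n S).

Lemma ricci_coef_neq0 : qc != 0.
Proof. by rewrite /ricci_coef /exp_rate !mulf_neq0 ?invr_eq0 //; apply/eqP. Qed.

Local Notation upot := (exp_potential f kap).
Local Notation dupot := (exp_differential f kap c).
Local Notation tracefree := (tracefree_ricci sc c).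
Local Notation phipot p :=
  (kap / beta * upot p * (rho * S + lambda p) - qc * sc * upot p).

Let fs : smooth_on (img c) (fun y => f (cinv c y)).
Proof. by case: einstein_type => sf _ _ _; exact: sf. Qed.
Let ls : smooth_on (img c) (fun y => lambda (cinv c y)).
Proof. by case: einstein_type => _ sl _ _; exact: sl. Qed.

Let us : smooth_on (img c) (fun y => upot (cinv c y)).
Proof.
move=> k; apply: Ck_expR; first exact: img_open.
apply: (@CkM _ _ k _ (cst kap) (fun y => f (cinv c y))); [exact: img_open| |exact: fs].
by apply: Ck_cst; exact: img_open.
Qed.

Lemma partial_upot i x : img c x ->
  partial i (fun y => upot (cinv c y)) x =
  kap * upot (cinv c x) * partial i (fun y => f (cinv c y)) x.
Proof.
move=> cx; have df := Ck_differentiable (@img_open _ _ _ c) (fs 1%N) cx.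
have dkf : differentiable (fun y => kap * f (cinv c y)) x by apply: differentiableZ.
have dexp : differentiable (@expR R) (kap * f (cinv c x)) by apply/derivable1_diffP/derivable_expR.
rewrite /partial deriveE; last first.
  exact: (@differentiable_comp _ _ _ _ (fun y => kap * f (cinv c y)) expR).
rewrite (diff_comp dkf dexp) /= (deriv1E (@derivable_expR _ _)) /= derive1E derive_val.
rewrite -deriveE // deriveZ; last exact: diff_derivable.
by rewrite /exp_potential /GRing.scale /=; ring.
Qed.

Lemma hessian_sym x : img c x -> (hessian f c x)^T = hessian f c x.
Proof.
move=> cx; apply/matrixP=> i j; rewrite [LHS]mxE [LHS]mxE [RHS]mxE.
refine (congr2 _ (smooth_partialC i j (@img_open _ _ _ c) cx fs) (congr1 _ _)).
pose U := @Domain R n (img c) (@img_open _ _ _ c) (ex_intro _ x cx).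
have UI y : U y -> img c y by [].
apply: eq_bigr => k _; refine (congr2 _ _ erefl).
rewrite -!(seval_schristoffel ac UI (U := U) cx).
exact: congr1 (torsion_free (schristoffel_levi_civita ac UI) _ _ _).
Qed.

(** Read off from the equation itself: alpha is nonzero and all other terms are symmetric. *)
Lemma ricci_sym x : img c x -> (ricci c x)^T = ricci c x.
Proof.
move=> cx; have [_ _ _ E] := einstein_type; have {}E := E c ac x cx.
have a0 : alpha != 0 by apply/eqP.
have -> : ricci c x = alpha^-1 *: ((rho * scalar_curvature c x + lambda (cinv c x)) *: metric c x
   - beta *: hessian f c x - mu *: tensor_square f c x).
  by rewrite -E [X in X - _]addrAC !addrK scalerA mulVf // scale1r.
have ts : (tensor_square f c x)^T = tensor_square f c x by rewrite /tensor_square trmx_mul trmxK.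
have hs := hessian_sym cx; have gs := Defs.metric_sym ac cx.
move: (hessian f c x) (tensor_square f c x) (metric c x) hs ts gs => X Y Z XE YE ZE.
by apply/matrixP=> i j; rewrite -{2}XE -{2}YE -{2}ZE !mxE.
Qed.

(** * The algebraic results on an open subset of a chart image *)

Section Domain.
Context {U : domain R n}.
Hypothesis UI : forall x, U x -> img c x.

Let g := smetric ac UI.
Let h := smetric_inv ac UI.
Let G := schristoffel ac UI.
Let D := @sderiv R n U.
Let HD : derivations D := @sderiv_derivations R n U.
Let Ric := ric D G.
Let s := sfun_cst (U := U) sc.
Let q := sfun_cst (U := U) qc.
Let A := Ric - s *: g.
Let fU := mk_sfun (smooth_restrict UI fs).
Let lU := mk_sfun (smooth_restrict UI ls).
Let uU := mk_sfun (smooth_restrict UI us).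
Let phU := sfun_cst kap * sfun_cst beta^-1 * uU * (sfun_cst (rho * S) + lU) - q * s * uU.

Let seval_A x (Ux : U x) : map_mx (seval Ux) A = tracefree x.
Proof.
rewrite /A map_mxB map_mxZ /= seval_cst seval_smetric; congr (_ - _).
exact: seval_ricci.
Qed.

Let du : 'cV[sfun U]_n := \col_i D i uU.

Let seval_du x (Ux : U x) : map_mx (seval Ux) du = dupot x.
Proof.
apply/matrixP=> i j; rewrite [LHS]mxE [X in seval Ux X]mxE [RHS]mxE.
exact: sderiv_mk.
Qed.

Let g_sym : g^T = g. Proof. exact: smetric_sym. Qed.
Let gh : g *m h = 1%:M. Proof. exact: smetricK. Qed.
Let HG : levi_civita D g G. Proof. exact: schristoffel_levi_civita. Qed.
Let ricE : Ric = A + s *: g. Proof. by rewrite /A subrK. Qed.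
Let s_cst i : D i s = 0. Proof. exact: sderiv_cst. Qed.
Let q_cst i : D i q = 0. Proof. exact: sderiv_cst. Qed.

Let A_sym : A^T = A.
Proof.
apply: seval_mx_inj => x Ux; rewrite -map_trmx seval_A /tracefree_ricci.
rewrite trmxB (ricci_sym (UI Ux)) linearZ /=.
by rewrite (Defs.metric_sym ac (UI Ux)).
Qed.

Let seval_hA x (Ux : U x) :
  map_mx (seval Ux) (h *m A) = ricci_endo c x - (sc)%:M.
Proof.
rewrite map_mxM seval_smetric_inv seval_A /tracefree_ricci mulmxBr -scalemxAr.
rewrite /metric_inv mulVmx ?scalemx1 //.
exact/posdef_unitmx/metric_posdef_at/UI.
Qed.

Let trA : \tr (h *m A) = 0.
Proof.
apply: seval_inj => x Ux; rewrite -trace_map_mx seval_hA mxtraceB.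
rewrite (trace_ricci_endo ac (UI Ux)) (scalar_cst (UI Ux)) mxtrace_scalar.
by rewrite raddf0 -[sc *+ n]mulr_natr /mean_ricci divfK // subrr.
Qed.

Let hess i : map_mx (D i) du - G i *m du = phU *: col i g - (q * uU) *: col i A.
Proof.
have a0 : alpha != 0 by apply/eqP.
have cD (x y : R) : sfun_cst (U := U) (x * y) = sfun_cst x * sfun_cst y.
  by apply: seval_inj => z Uz; rewrite rmorphM /= !seval_cst.
apply: (@exp_hessian _ n D g A G fU uU (sfun_cst (rho * S) + lU) s (sfun_cst alpha)
  (sfun_cst beta) (sfun_cst beta^-1) (sfun_cst mu) (sfun_cst kap) q).
- exact: HD.
- exact: g_sym.
- exact: A_sym.
- by move=> j; exact: sderiv_cst.
- move=> j; apply: seval_inj => x Ux.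
  rewrite [RHS]rmorphM [X in X * _]rmorphM /= seval_cst [seval Ux uU]seval_mk.
  refine (etrans (sderiv_mk j _ Ux) (etrans (partial_upot j (UI Ux)) _)).
  exact: congr1 (esym (sderiv_mk j _ Ux)).
- by rewrite -cD mulVf //; apply: seval_inj => x Ux; rewrite seval_cst rmorph1.
- by rewrite -cD.
- by rewrite -!cD.
- move=> j k; apply: seval_inj => x Ux.
  have [_ _ _ E] := einstein_type; have {}E := E c ac x (UI Ux).
  have {E} := congr1 (fun X : 'M[R]_n => X j k) E.
  rewrite (scalar_cst (UI Ux)) => E.
  have e1 : seval Ux ((A + s *: g) j k) = ricci c x j k.
    by rewrite -ricE -(seval_ricci ac UI Ux) [RHS]mxE.
  have e2 : seval Ux (D j (D k fU) - \sum_l G j k l * D l fU) = hessian f c x j k.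
    rewrite raddfB raddf_sum /= [RHS]mxE; refine (congr2 _ _ (congr1 _ _)).
      refine (etrans (sderivE j _ Ux) _).
      by apply: (partial_eq_on _ (domain_open U) Ux) => y Uy; exact: sderiv_mk.
    apply: eq_bigr => l _; rewrite rmorphM /=; refine (congr2 _ _ _).
      exact: seval_schristoffel.
    by rewrite [RHS]mxE; exact: sderiv_mk.
  have e3 t : seval Ux (D t fU) = differential_mx f c x 0 t.
    by rewrite [RHS]mxE; exact: sderiv_mk.
  rewrite 2!raddfD /= !rmorphM /= !seval_cst e1 e2 raddfD /= seval_cst !e3.
  rewrite [seval Ux lU]seval_mk -(seval_smetric ac UI Ux) in E *.
  have lin (X Y Z : 'M[R]_n) : (alpha *: X + beta *: Y + mu *: Z) j k =
    alpha * X j k + beta * Y j k + mu * Z j k by rewrite !mxE.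
  have ts : tensor_square f c x j k = differential_mx f c x 0 j * differential_mx f c x 0 k.
    by rewrite [LHS]mxE big_ord1 [X in X * _]mxE.
  by move: E; rewrite lin ts => ->; rewrite [LHS]mxE [X in _ * X]mxE.
Qed.

(** Here beta^2 (1 + q) = beta^2 + mu alpha, nonzero by [beta2]. *)
Let q1_regular (a : sfun U) : (1 + q) * a = 0 -> a = 0.
Proof.
have -> : 1 + q = sfun_cst (1 + qc).
  by apply: seval_inj => x Ux; rewrite raddfD /= rmorph1 !seval_cst.
apply: sfun_cst_regular; apply/eqP => e; apply: beta2.
have b0 := beta0; have : beta ^+ 2 * (1 + qc) = 0 by rewrite e mulr0.
rewrite /ricci_coef /exp_rate => /eqP; rewrite mulrDr mulr1 addr_eq0 => /eqP ->.
by congr (- _); field.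
Qed.

(** Here beta^2 (1 - (n - 2) q) = beta^2 - (n - 2) alpha mu, nonzero by nondegeneracy. *)
Let q2_regular (a : sfun U) : (1 - (n%:R - 2) * q) * a = 0 -> a = 0.
Proof.
have -> : 1 - (n%:R - 2) * q = sfun_cst (1 - (n%:R - 2) * qc).
  apply: seval_inj => x Ux.
  by rewrite raddfB /= rmorph1 rmorphM raddfB /= !rmorph_nat !seval_cst.
apply: sfun_cst_regular; apply/eqP => e; case: nondegenerate => H _; apply: H.
have b0 := beta0; have : beta ^+ 2 * (1 - (n%:R - 2) * qc) = 0 by rewrite e mulr0.
rewrite /ricci_coef /exp_rate => /eqP; rewrite mulrBr mulr1 subr_eq0 => /eqP ->.
by field.
Qed.

Let seval_X x (Ux : U x) : map_mx (seval Ux) (A *m h *m du) =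
  tracefree x *m metric_inv c x *m dupot x.
Proof. by rewrite !map_mxM seval_A seval_smetric_inv seval_du. Qed.

(** Serves the continuity of the eigenvalue, a quotient of two such components. *)
Lemma continuous_gradient x i : U x ->
  {for x, continuous (fun y => dupot y i 0)} /\
  {for x, continuous (fun y => (tracefree y *m metric_inv c y *m dupot y) i 0)}.
Proof.
have sfunC (F : sfun U) (h' : 'rV[R]_n -> R) : (forall y, U y -> F y = h' y) -> U x ->
    {for x, continuous h'}.
  move=> Fh Ux; apply: near_eq_continuous (near_eq_on (domain_open U) Ux Fh) _.
  exact: (Ck_continuous (domain_open U) (sfun_smooth F 0%N) Ux).
move=> Ux; split.
- apply: (sfunC (D i uU)) => // y Uy; rewrite [RHS]mxE; exact: sderiv_mk.
- by apply: (sfunC ((A *m h *m du) i 0)) => // y Uy; rewrite -(seval_X Uy) [RHS]mxE.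
Qed.

Lemma gradient_parallel_in x i j : U x ->
  let X := tracefree x *m metric_inv c x *m dupot x in
  X i 0 * dupot x j 0 = X j 0 * dupot x i 0.
Proof.
move=> Ux /=.
have := gradient_parallel HD (@sfun_two_regular R n U) g_sym gh HG ricE A_sym s_cst trA
  q_cst hess q1_regular q2_regular i j.
move=> /(congr1 (seval Ux)).
have eX t : seval Ux ((A *m h *m du) t 0) = (tracefree x *m metric_inv c x *m dupot x) t 0.
  by rewrite -seval_X [RHS]mxE.
have eD t : seval Ux (D t uU) = dupot x t 0 by rewrite [RHS]mxE; exact: sderiv_mk.
rewrite /= -(eX i) -(eX j) -(eD i) -(eD j) => e.
exact: (etrans (esym (rmorphM (seval Ux) _ _)) (etrans e (rmorphM (seval Ux) _ _))).
Qed.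

Lemma eigen_divergence_in sigma x :
  (forall y, U y -> tracefree y *m metric_inv c y *m dupot y = sigma *: dupot y) ->
  U x ->
  - (qc * upot (cinv c x) * \tr ((ricci_endo c x - (sc)%:M) *m (ricci_endo c x - (sc)%:M)))
  = n%:R * sigma * phipot (cinv c x).
Proof.
move=> eig Ux.
have XE : A *m h *m du = sfun_cst sigma *: du.
  apply: seval_mx_inj => y Uy; rewrite seval_X map_mxZ /= seval_cst seval_du.
  exact: eig.
have := eigen_divergence HD (@sfun_two_regular R n U) g_sym gh HG ricE A_sym s_cst trA
  hess (fun i => sderiv_cst i sigma) XE.
move=> /(congr1 (seval Ux)).
have eT : seval Ux (\tr (h *m A *m h *m A)) =
    \tr ((ricci_endo c x - sc%:M) *m (ricci_endo c x - sc%:M)).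
  by rewrite -trace_map_mx -(mulmxA (h *m A)) map_mxM seval_hA.
have eP : seval Ux phU = phipot (cinv c x).
  rewrite raddfB /= !rmorphM raddfD /= !seval_cst.
  by rewrite [seval Ux lU]seval_mk [seval Ux uU]seval_mk.
rewrite raddfN /= 2![in LHS]rmorphM 2![in RHS]rmorphM rmorph_nat /= eT eP !seval_cst.
by rewrite [seval Ux uU]seval_mk.
Qed.

(** With du = 0 the Hessian equation reads phi g = q u A. Its trace kills phi since [A] is
    tracefree, and q u has no zero. *)
Lemma tracefree_eq0_in x : (forall y, U y -> dupot y = 0) -> U x -> tracefree x = 0.
Proof.
move=> d0 Ux.
have du0 : du = 0 by apply: seval_mx_inj => y Uy; rewrite seval_du d0 // map_mx0.
have E : phU *: g = (q * uU) *: A.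
  apply/matrixP => j i; have := hess i; rewrite du0 mulmx0 subr0.
  move=> /(congr1 (fun X : 'cV[sfun U]_n => X j 0)).
  rewrite [LHS]mxE [X in D i X]mxE (deriv0 HD) => /esym/eqP.
  have lin (X Y : 'cV[sfun U]_n) a b : (a *: X - b *: Y) j 0 = a * X j 0 - b * Y j 0.
    by rewrite !mxE.
  rewrite lin subr_eq0 => /eqP; rewrite [col i g _ _]mxE [col i A _ _]mxE => e.
  by rewrite [LHS]mxE [RHS]mxE.
have ph0 : phU = 0.
  have := congr1 (fun X => \tr (h *m X)) E.
  rewrite -!scalemxAr !mxtraceZ trA mulr0 (mulmx1C gh) mxtrace1 mulrC => e.
  apply: (@sfun_cst_regular R n U n%:R) => //.
  suff -> : sfun_cst n%:R = n%:R :> sfun U by [].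
  by apply: seval_inj => y Uy; rewrite seval_cst rmorph_nat.
have := congr1 (map_mx (seval Ux)) E; rewrite ph0 scale0r map_mx0 map_mxZ /= seval_A.
rewrite rmorphM /= seval_cst [seval Ux uU]seval_mk => /esym/eqP.
rewrite scaler_eq0 mulf_eq0 [upot _ == 0]gt_eqF ?expR_gt0 // orbF => /orP[|/eqP //].
by rewrite (negbTE ricci_coef_neq0).
Qed.

End Domain.
End LocalEinsteinType.

(** * Finite sets of values and connectedness *)

Lemma finite_roots (F : idomainType) (p : {poly F}) : p != 0 ->
  exists rs : seq F, forall t, root p t -> t \in rs.
Proof.
elim: (size p) {-2}p (leqnn (size p)) => [|m IH] {}p.
  by rewrite leqn0 size_poly_eq0 => /eqP ->; rewrite eqxx.
move=> sp p0; have [[t0 rt0]|nr] := pselect (exists t, root p t); last first.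
  by exists [::] => t rt; case: nr; exists t.
have /factor_theorem[q qE] := rt0.
have q0 : q != 0 by apply: contra p0 => /eqP q0; rewrite qE q0 mul0r.
have [|rs Hrs] := IH q _ q0.
  move: sp; rewrite qE size_Mmonic ?monicXsubC // size_XsubC addn2 /= ltnS //.
by exists (t0 :: rs) => t; rewrite qE rootM root_XsubC inE => /orP[/Hrs ->|->]; rewrite ?orbT.
Qed.

Lemma finite_isolated (R : realType) (T : seq R) (t0 : R) :
  exists2 e, 0 < e & forall t, t \in T -> `|t0 - t| < e -> t = t0.
Proof.
elim: T => [|a T [e e0 He]]; first by exists 1.
have [->|at0] := eqVneq a t0.
  by exists e => // t; rewrite inE => /orP[/eqP -> //|/He]; apply.
have d0 : 0 < `|t0 - a| by rewrite normr_gt0 subr_eq0 eq_sym.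
exists (Num.min e `|t0 - a|); first by rewrite lt_min e0.
move=> t; rewrite inE lt_min => /orP[/eqP ->|/He H] /andP[]; last by move=> /H.
by rewrite ltxx.
Qed.

(** A level set is open because its value is isolated in [T], and closed by continuity. *)
Lemma connected_finite_valued (R : realType) (X : topologicalType) (l : X -> R) (T : seq R) :
  connected [set: X] -> continuous l -> (forall p, l p \in T) -> forall p q, l p = l q.
Proof.
move=> cX cl lT p q; pose B := [set z | l z = l p].
suff : B = [set: X] by move/seteqP => [_ /(_ q I)].
apply: cX; first by exists p.
- exists B; last by rewrite setTI.
  rewrite openE => z Bz; have [e e0 He] := finite_isolated T (l z).
  have /cvgrPdist_lt/(_ e e0) := cl z.
  by apply: filterS => w lw; rewrite /B /= -Bz; apply: He.
- exists B; last by rewrite setTI.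
  have -> : B = l @^-1` [set l p] by [].
  by move/continuous_closedP: cl; apply; exact: closed_eq.
Qed.

Lemma chart_continuous (R : realType) (n : nat) (M : topologicalType) (c : chart R n M)
    (l : M -> R) (p : M) :
  dom c p -> {for cmap c p, continuous (fun y => l (cinv c y))} -> {for p, continuous l}.
Proof.
move=> dp cl.
have cm : {for p, continuous (cmap c)}.
  have := @cmap_continuous _ _ _ c; rewrite continuous_open_subspace; last exact: dom_open.
  by move=> /(_ p); apply; rewrite inE.
apply: (@near_eq_continuous _ _ (fun z => l (cinv c (cmap c z)))).
  have := open_nbhs_nbhs (conj (@dom_open _ _ _ c) dp).
  by apply: filterS => z dz; rewrite cmapK.
exact: (continuous_comp cm cl).
Qed.

Lemma conj_subr_scalar (F : fieldType) (n : nat) (P A B : 'M[F]_n) (s : F) :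
  P \in unitmx -> A = P *m B *m invmx P ->
  A - s%:M = P *m (B - s%:M) *m invmx P.
Proof.
move=> uP ->; rewrite mulmxBr mulmxBl scalar_mxC -(mulmxA _%:M) mulmxV //.
by rewrite mulmx1.
Qed.

Lemma tracefree_endo (R : realType) (n : nat) (M : riemannianManifold R n) (s : R)
    (c : chart R n M) (x : 'rV[R]_n) : atlas c -> img c x ->
  metric_inv c x *m tracefree_ricci s c x = ricci_endo c x - s%:M.
Proof.
move=> ac cx; rewrite /tracefree_ricci mulmxBr -scalemxAr /metric_inv mulVmx ?scalemx1 //.
exact/posdef_unitmx/metric_posdef_at.
Qed.

(** * Constancy of lambda when the tracefree Ricci tensor is nonzero *)

Section Global.
Context {R : realType} {n : nat} {M : riemannianManifold R n}.
Context {f lambda : M -> R} {alpha beta mu rho S N : R} {p : {poly R}}.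
Hypothesis n_ge3 : (3 <= n)%N.
Hypothesis einstein_type : gradient_einstein_type f lambda alpha beta mu rho.
Hypothesis nondegenerate : nondegenerate_constants n alpha beta mu.
Hypothesis mu_neq0 : mu <> 0.
Hypothesis alpha_neq0 : alpha <> 0.
Hypothesis beta2 : beta ^+ 2 <> - (mu * alpha).
Hypothesis scalar_cst : forall (c : chart R n M) x, atlas c -> img c x ->
  scalar_curvature c x = S.
Hypothesis norm_cst : forall (c : chart R n M) x, atlas c -> img c x ->
  \tr ((ricci_endo c x - (mean_ricci n S)%:M) *m (ricci_endo c x - (mean_ricci n S)%:M)) = N.
Hypothesis poly_cst : forall (c : chart R n M) x, atlas c -> img c x ->
  char_poly (ricci_endo c x) = p.
Hypothesis N_neq0 : N != 0.

Local Notation s := (mean_ricci n S).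
Local Notation q := (ricci_coef alpha beta mu).
Local Notation k := (exp_rate beta mu).

Let beta0 : beta != 0. Proof. by apply/eqP; case: nondegenerate. Qed.
Let n0 : n%:R != 0 :> R.
Proof. by rewrite pnatr_eq0 -lt0n; apply: leq_trans n_ge3. Qed.
Let k0 : k != 0.
Proof. by rewrite /exp_rate mulf_neq0 ?invr_eq0 //; apply/eqP. Qed.

(** The solution for lambda of - q u N = n sigma phi, where phi = (k / beta) u (rho S + lambda) - q
    s u and sigma = r - s; the factor u cancels. Here r is an eigenvalue of the Ricci endomorphism
    and sigma the matching one of A. *)
Definition lambda_of_eigenvalue (r : R) : R :=
  beta / k * (q * s - q * N / (n%:R * (r - s))) - rho * S.

(** Transposing the relation makes the row du^T an eigenvector of [ricci_endo c x], the scalar part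
    of the tracefree tensor shifting sigma by s. *)
Lemma eigenvalue_root (c : chart R n M) x sigma : atlas c -> img c x ->
  exp_differential f k c x != 0 ->
  tracefree_ricci s c x *m metric_inv c x
    *m exp_differential f k c x
  = sigma *: exp_differential f k c x ->
  root p (sigma + s).
Proof.
move=> ac cx; move: (exp_differential f k c x) => w w0 E.
rewrite -(poly_cst ac cx) -eigenvalue_root_char; apply/eigenvalueP.
exists w^T; last by apply: contra w0 => /eqP e; rewrite -[w]trmxK e trmx0.
have sA : (tracefree_ricci s c x)^T = tracefree_ricci s c x.
  rewrite /tracefree_ricci trmxB linearZ /= (ricci_sym einstein_type alpha_neq0 ac cx).
  by rewrite (Defs.metric_sym ac cx).
have sh : (metric_inv c x)^T = metric_inv c x by rewrite /metric_inv trmx_inv Defs.metric_sym.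
have := congr1 trmx E; rewrite !trmx_mul sA sh linearZ /= tracefree_endo //.
by rewrite mulmxBr mul_mx_scalar => /eqP; rewrite subr_eq -scalerDl => /eqP.
Qed.

(** Near x the quotient [sigma] is continuous with values in a finite set, hence constant on an open
    [W]; there [eigen_divergence_in] applies and can be solved for lambda. *)
Lemma lambda_at_regular_point (c : chart R n M) x : atlas c -> img c x ->
  exp_differential f k c x != 0 ->
  exists2 r, root p r & lambda (cinv c x) = lambda_of_eigenvalue r.
Proof.
move=> ac cx dx0.
pose du := exp_differential f k c.
pose X y := tracefree_ricci s c y *m metric_inv c y *m du y.
have [i0 di0] : exists i0, du x i0 0 != 0.
  apply/existsP; apply: contraNT dx0; rewrite negb_exists => /forallP H.
  by apply/eqP/matrixP => i j; rewrite ord1 [RHS]mxE; apply/eqP; have := H i; rewrite negbK.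
pose U := @Domain R n (img c) (@img_open _ _ _ c) (ex_intro _ x cx).
have UI y : U y -> img c y by [].
have scal_c := fun y => scalar_cst (c := c) (x := y) ac.
pose sigma y := X y i0 0 / du y i0 0.
have XE y : img c y -> du y i0 0 != 0 -> X y = sigma y *: du y.
  move=> cy dy0; apply/matrixP => i j; rewrite ord1 [RHS]mxE /sigma mulrAC.
  apply: (canRL (mulfK dy0)).
  exact: (gradient_parallel_in n_ge3 einstein_type nondegenerate alpha_neq0 beta2
    ac scal_c UI i i0 cy).
have root_sigma y : img c y -> du y i0 0 != 0 -> root p (sigma y + s).
  move=> cy dy0; apply: (eigenvalue_root ac cy _ (XE y cy dy0)).
  by apply: contraNneq dy0 => e; rewrite /du e mxE.
have [duC XC] : {for x, continuous (fun y => du y i0 0)} /\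
    {for x, continuous (fun y => X y i0 0)}.
  exact: (continuous_gradient einstein_type ac UI i0 cx).
have sigmaC : {for x, continuous sigma}.
  by apply: continuousM; [exact: XC | apply: continuousV; [exact: di0 | exact: duC]].
have [rs rsP] : exists rs : seq R, forall t, root p t -> t \in rs.
  by apply: finite_roots; rewrite -(poly_cst ac cx) monic_neq0 ?char_poly_monic.
have [e e0 eP] := finite_isolated [seq r - s | r <- rs] (sigma x).
have N1 : \forall y \near x, `|sigma x - sigma y| < e.
  by move/cvgrPdist_lt: sigmaC; apply.
(* This bound keeps the component [i0] of du nonzero, so [sigma y] remains a genuine eigenvalue. *)
have N2 : \forall y \near x, `|du x i0 0 - du y i0 0| < `|du x i0 0|.
  by move/cvgrPdist_lt: duC; apply; rewrite normr_gt0.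
have N3 := @filterI _ (nbhs x) (nbhs_filter x) _ _ (open_nbhs_nbhs (conj (@img_open _ _ _ c) cx))
  (@filterI _ (nbhs x) (nbhs_filter x) _ _ N1 N2).
set B := (X in nbhs x X) in N3.
pose W := @Domain R n B° (open_interior B) (ex_intro _ x N3).
have WB y : W y -> B y by apply: interior_subset.
have WI y : W y -> img c y by move=> /WB [].
have eig y : W y -> tracefree_ricci s c y *m metric_inv c y *m du y = sigma x *: du y.
  move=> /WB [cy [sy dy]].
  have dy0 : du y i0 0 != 0.
    by apply: contraTneq dy => ->; rewrite subr0 ltxx.
  rewrite (_ : sigma x = sigma y); first exact: XE.
  apply/esym/eP => //; rewrite -[sigma y](addrK s); apply: map_f.
  by apply: rsP; exact: root_sigma.
have Wx : W x by exact: N3.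
have H := eigen_divergence_in n_ge3 einstein_type nondegenerate alpha_neq0
  ac scal_c WI eig Wx.
exists (sigma x + s); first exact: root_sigma.
have u0 : exp_potential f k (cinv c x) != 0 by rewrite gt_eqF ?expR_gt0.
have q0 : q != 0 by apply: (ricci_coef_neq0 nondegenerate mu_neq0 alpha_neq0).
move: H; rewrite norm_cst // /lambda_of_eigenvalue addrK.
move: (exp_potential f k (cinv c x)) u0 (sigma x) (lambda _) => u u0 sg l.
move: q q0 s k k0 => a a0 b t t0 E.
(* A zero eigenvalue would force q u N = 0, against [N_neq0]. *)
have sg0 : sg != 0.
  by apply: contra_eq_neq E => ->; rewrite mulr0 mul0r oppr_eq0 !mulf_neq0.
have b0 := beta0; have nn0 := n0.
have E2 : t / beta * u * (rho * S + l) = a * b * u - a * u * N / (n%:R * sg).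
  have -> : a * u * N = - (n%:R * sg * (t / beta * u * (rho * S + l) - a * b * u)) by rewrite -E opprK.
  by field; rewrite sg0 nn0 b0.
transitivity (t / beta * u * (rho * S + l) * (beta / (t * u)) - rho * S).
  by field; rewrite ?t0 ?b0 ?u0.
by rewrite E2; field; rewrite ?t0 ?u0 ?nn0 ?sg0 ?b0.
Qed.

(** If du vanished throughout [V], the tracefree Ricci tensor would be zero there, and so would its
    squared norm [N]. *)
Lemma regular_point_dense (c : chart R n M) (V : set 'rV[R]_n) : atlas c ->
  open V -> V `<=` img c -> V !=set0 -> exists2 y, V y & exp_differential f k c y != 0.
Proof.
move=> ac oV VI [x Vx].
have [//|nreg] := pselect (exists2 y, V y & exp_differential f k c y != 0).
pose W := @Domain R n V oV (ex_intro _ x Vx).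
have scal_c := fun y => scalar_cst (c := c) (x := y) ac.
have d0 y : W y -> exp_differential f k c y = 0.
  by move=> Wy; apply/eqP; apply: contra_notT nreg => dy; exists y.
have Wx : W x by exact: Vx.
have WI y : W y -> img c y by exact: VI.
have t0 := tracefree_eq0_in n_ge3 einstein_type nondegenerate mu_neq0 alpha_neq0
  ac scal_c WI d0 Wx.
have := norm_cst ac (WI x Wx); rewrite -(tracefree_endo _ ac (WI x Wx)) t0 mulmx0 mul0mx.
by rewrite mxtrace0 => /esym/eqP; rewrite (negbTE N_neq0).
Qed.

(** The values of lambda at regular points lie in the image of the finite root set. Density and
    continuity extend this to every point, since a finite set is closed. *)
Lemma lambda_constant z w : lambda z = lambda w.
Proof.
have lC : continuous lambda.
  move=> a; have [c ac da] := atlas_cover a; apply: (chart_continuous da).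
  have [_ sl _ _] := einstein_type.
  have ca : img c (cmap c a) by exists a.
  exact: (Ck_continuous (@img_open _ _ _ c) (sl c ac 0%N)).
have [rs rsP] : exists rs : seq R, forall t, root p t -> t \in rs.
  have [c ac da] := atlas_cover z; have cz : img c (cmap c z) by exists z.
  by apply: finite_roots; rewrite -(poly_cst ac cz) monic_neq0 ?char_poly_monic.
apply: (connected_finite_valued (T := map lambda_of_eigenvalue rs)
  (@carrier_connected _ _ M) lC) => a.
have [c ac da] := atlas_cover a.
have [e e0 eP] := finite_isolated (map lambda_of_eigenvalue rs) (lambda a).
have ca : img c (cmap c a) by exists a.
have lcC : {for cmap c a, continuous (fun y => lambda (cinv c y))}.
  have [_ sl _ _] := einstein_type.
  exact: (Ck_continuous (@img_open _ _ _ c) (sl c ac 0%N)).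
have N1 : \forall y \near cmap c a, `|lambda (cinv c (cmap c a)) - lambda (cinv c y)| < e.
  by move/cvgrPdist_lt: lcC; apply.
have N3 := @filterI _ (nbhs (cmap c a)) (nbhs_filter _) _ _
  (open_nbhs_nbhs (conj (@img_open _ _ _ c) ca)) N1.
set B := (X in nbhs _ X) in N3.
have [y By dy] : exists2 y, B° y & exp_differential f k c y != 0.
  apply: regular_point_dense ac (open_interior B) _ _.
    by move=> y /interior_subset [].
  by exists (cmap c a).
have [cy ly] := interior_subset By.
have [r rp lr] := lambda_at_regular_point ac cy dy.
have lT : lambda (cinv c y) \in map lambda_of_eigenvalue rs by rewrite lr map_f // rsP.
(* The value at [y] lies in the finite set and within [e] of [lambda a], so by the choice of [e] the
   two agree. *)
by rewrite -(eP _ lT) //; move: ly; rewrite cmapK.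
Qed.

End Global.

Theorem theorem3 (R : realType) (n : nat) (M : riemannianManifold R n)
    (f lambda : M -> R) (alpha beta mu rho : R) :
  (3 <= n)%N ->
  homogeneous M ->
  noncompact M ->
  gradient_einstein_type f lambda alpha beta mu rho ->
  proper_function lambda ->
  nondegenerate_constants n alpha beta mu ->
  mu <> 0 ->
  alpha <> 0 ->
  beta ^+ 2 <> - (mu * alpha) ->
  einstein M.
Proof.
move=> n3 homM _ ein [z [w zw]] nondeg mu0 alpha0 beta2.
have [c0 ac0 dc0] := atlas_cover z; pose x0 := cmap c0 z.
have cx0 : img c0 x0 by exists z.
pose S := scalar_curvature c0 x0; pose s := mean_ricci n S.
have scalar_cst (c : chart R n M) x : atlas c -> img c x -> scalar_curvature c x = S.
  move=> ac cx; have [P uP PE] := ricci_endo_conj homM ac ac0 cx cx0.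
  by rewrite /S -(trace_ricci_endo ac cx) -(trace_ricci_endo ac0 cx0) PE mxtrace_conj.
have poly_cst (c : chart R n M) x : atlas c -> img c x ->
    char_poly (ricci_endo c x) = char_poly (ricci_endo c0 x0).
  move=> ac cx; have [P uP PE] := ricci_endo_conj homM ac ac0 cx cx0.
  by rewrite PE char_poly_conj.
(* The squared norm of the tracefree Ricci tensor, written through its endomorphism so that
   conjugation shows it to be constant. *)
pose norm2 c x := \tr ((ricci_endo c x - s%:M) *m (@ricci_endo R n M c x - s%:M)).
have norm_cst (c : chart R n M) x : atlas c -> img c x -> norm2 c x = norm2 c0 x0.
  move=> ac cx; have [P uP PE] := ricci_endo_conj homM ac ac0 cx cx0.
  rewrite /norm2 (conj_subr_scalar _ uP PE) !mulmxA mulmxKV //.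
  by rewrite -(mulmxA P) mxtrace_conj.
(* The nonzero case contradicts properness; in the other case definiteness of the metric makes the
   tracefree tensor vanish at every point. *)
have [N0|N0] := eqVneq (norm2 c0 x0) 0; last first.
  case: zw; exact: (lambda_constant n3 ein nondeg mu0 alpha0 beta2 scalar_cst norm_cst poly_cst N0).
move=> c ac x cx; rewrite scalar_cst // -/s; apply/eqP; rewrite -subr_eq0; apply/eqP.
apply: (@posdef_trace_eq0 R n (metric c x)).
- exact: Defs.metric_sym.
- exact: metric_posdef_at.
- rewrite trmxB linearZ /= (ricci_sym ein alpha0 ac cx).
  by rewrite (Defs.metric_sym ac cx).
- have := tracefree_endo s ac cx; rewrite /tracefree_ricci /metric_inv => ->.
  by rewrite -[LHS]/(norm2 c x) norm_cst.
Qed.
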